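(* Let $k, t, n$ be positive integers with $n\geq k+1$, let $V$ be an $n$-dimensional vector space over the finite field $\mathbb{F}_q$, and let $\mathcal{F}\subseteq \left[{V\atop k}\right]$ be a cover-free family. Then the following hold. (i) If $k=2t$, then $$|\mathcal{F}| \leq \frac{\left[{n-1\atop t}\right]}{\left[{2t-1\atop t}\right]}.$$ Moreover, equality holds if and only if $\mathcal{F}=\{E\oplus S: S\in \mathcal{S}\}$ for some $E\in \left[{V\atop 1}\right]$ and some $q$-Steiner system $\mathcal{S}$ with parameters $S_{q}(t, 2t-1, n-1)$ on some $W\in \left[{V\atop n-1}\right]$ satisfying $E\oplus W=V$. (ii) If $k=2t-1$, then $$|\mathcal{F}| \leq \frac{\left[{n\atop t}\right]}{\left[{2t-1\atop t}\right]}.$$ Moreover, equality holds if and only if $\mathcal{F}$ is a $q$-Steiner system $S_{q}(t, 2t-1, n)$ on $V$.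
   Context: For a finite-dimensional vector space $U$ over $\mathbb{F}_q$, $\left[{U\atop k}\right]$ denotes the set of all $k$-dimensional subspaces of $U$. For numbers, $\left[{m\atop k}\right]=\prod_{i=0}^{k-1}\frac{q^{m-i}-1}{q^{k-i}-1}$ is the Gaussian binomial coefficient. A family $\mathcal{F}\subseteq \left[{V\atop k}\right]$ is cover-free if there are no three distinct subspaces $F_0,F_1,F_2\in\mathcal{F}$ with $F_0\leq (F_0\cap F_1)+(F_0\cap F_2)$, where $\leq$ means ''is a subspace of''. A family $\mathcal{H}\subseteq \left[{U\atop k}\right]$, where $\dim U=u$, is a $q$-Steiner system $S_q(t,k,u)$ on $U$ if for every $T\in\left[{U\atop t}\right]$ there is exactly one $H\in\mathcal{H}$ with $T\leq H$. The symbol $A\oplus B$ denotes $A+B$ when $A\cap B=\{\mathbf{0}\}$. *)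

(* Defs.v *)
From HB Require Import structures.
From mathcomp Require Import all_boot all_order all_algebra.

Set Implicit Arguments.
Unset Strict Implicit.
Unset Printing Implicit Defensive.

Import Order.TTheory GRing.Theory Num.Theory.

Local Open Scope ring_scope.

(* Over a finite field there are finitely many subspaces (a subspace is stored
   as a canonical square matrix), so that families of subspaces can be taken in
   {set {vspace vT}}. *)
Section FiniteVspace.
Import VectorInternalTheory.
Variables (F : finFieldType) (vT : vectType F).
HB.instance Definition _ := [Countable of {vspace vT} by <:].
HB.instance Definition _ := [Finite of {vspace vT} by <:].
End FiniteVspace.

(* The exponent m - i is truncated, but the product already contains the zero
   factor i = m whenever some i > m occurs in it. *)
Definition gauss_binom (q m k : nat) : rat :=
  \prod_(i < k) ((q%:R ^+ (m - i)%N - 1) / (q%:R ^+ (k - i)%N - 1)).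

Section Families.
Variables (F : finFieldType) (vT : vectType F).
Implicit Types (U : {vspace vT}) (FF HH : {set {vspace vT}}).

Definition subspaces_of_dim U (k : nat) : {set {vspace vT}} :=
  [set H : {vspace vT} | (H <= U)%VS & \dim H == k].

Definition cover_free FF : Prop :=
  ~ exists F0 F1 F2 : {vspace vT},
      [/\ F0 \in FF, F1 \in FF & F2 \in FF] /\
      [/\ F0 != F1, F0 != F2 & F1 != F2] /\
      (F0 <= (F0 :&: F1) + (F0 :&: F2))%VS.

Definition q_Steiner_system (t k u : nat) U HH : Prop :=
  [/\ \dim U = u,
      HH \subset subspaces_of_dim U k
    & forall T, T \in subspaces_of_dim U t ->
        exists! H : {vspace vT}, H \in HH /\ (T <= H)%VS].

End Families.

(* Main.v *)
Require Import Defs.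
From HB Require Import structures.
From mathcomp Require Import all_boot all_order all_algebra.
From mathcomp Require Import all_fingroup all_solvable all_field mxabelem.
From mathcomp Require Import zify ring lra.

Set Implicit Arguments.
Unset Strict Implicit.
Unset Printing Implicit Defensive.

Import Order.TTheory GRing.Theory Num.Theory.

Local Open Scope ring_scope.

(* A subspace of a member F that lies in a second member is called heavy, and
   one that lies in no other member is owned by F; two heavy subspaces of F never
   span F.  Every t-space of V is owned by at most one member, so it suffices to
   find enough owned t-spaces.

   k = 2t-1: a heavy t-space of F forces all its complements in F, of dimension
   t-1, to be owned, so F has at least as many owned (t-1)-spaces as heavy
   t-spaces.  A t-space over an owned (t-1)-space of F but not inside F is
   contained in no member at all, and these wasted t-spaces outweigh the heavy
   ones.

   k = 2t: the heavy t-spaces of F form an intersecting family, of size at most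
   c = [2t-1, t] by the Greene-Kleitman spread argument.  If F meets all other
   members in dimension at most t, each heavy t-space is shared by at most
   (q^(n-t)-1)/(q^t-1) such members, since they form a partial spread of the
   quotient; otherwise F owns many (t-1)-spaces and wastes more than it loses.
   In the extremal case every t-space is covered, and the members through a heavy
   t-space T cover every (t+1)-space over T.  Call a subspace full if every t-space
   above it is heavy; then a subspace lying in two full subspaces of one dimension
   more is itself full.  Double counting descends from full t-spaces (the heavy
   ones) to full points, which gives the point E common to all members. *)

(* The roots of X^(q^t) - X in its splitting field are the fixed points of the t-th
   power of the Frobenius automorphism, hence the whole splitting field. *)
Lemma finField_ext_exists (F : finFieldType) (t : nat) :
  (0 < t)%N -> {L : fieldExtType F | \dim {:L} = t}.
Proof.
move=> t_gt0; set m := (#|F| ^ t)%N.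
have m_gt1 : (1 < m)%N by rewrite -(exp1n t) ltn_exp2r // finNzRing_gt1.
have size_q (R : nzRingType) : size ('X^m - 'X : {poly R}) = m.+1.
  by rewrite size_polyDl size_polyXn // size_polyN size_polyX.
have /FinSplittingFieldFor[/= L] : 'X^m - 'X != 0 :> {poly F}.
  by rewrite -size_poly_gt0 size_q.
rewrite [map_poly _ _]rmorphB rmorphXn /= map_polyX => splitL.
exists L; have [zs DqL defL] := splitL.
have [a _ Da] := finField_galois_generator (sub1v {:L}%AS).
rewrite dimv1 expn1 in Da.
have mL0 : m%:R = 0 :> L.
  have qF0 : #|F|%:R = 0 :> F.
    by rewrite -cardsT -[_%:R]FinRing.zmodXgE expg_cardG ?inE.
  by rewrite -(rmorph_nat (in_alg L)) /m natrX qF0 expr0n gtn_eqF ?rmorph0.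
(* The derivative of X^m - X is -1 because [m] vanishes in [L], so the roots are distinct. *)
have uniq_zs : uniq zs.
  rewrite -separable_prod_XsubC -(eqp_separable DqL) unlock.
  rewrite derivB derivXn derivX -mulr_natl -polyC_natr mL0 mul0r sub0r.
  by rewrite -[X in coprimep _ X]scaleN1r coprimepZr ?oppr_eq0 ?oner_eq0 // coprimep1.
have aXE i x : (a ^+ i)%g x = x ^+ (#|F| ^ i).
  elim: i => [|i IHi]; first by rewrite gal_id.
  by rewrite expgSr expnSr exprM galM ?memvf // IHi Da ?memvf.
have zsE : zs =i fixedSpace (a ^+ t)%g.
  move=> z; rewrite -root_prod_XsubC -(eqp_root DqL) (sameP fixedSpaceP eqP) aXE.
  by rewrite /root !hornerE subr_eq0.
have zsL x : x \in zs.
  (* The fixed points form a subfield that contains every root, and the roots generate [L]. *)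
  suff fixL : ({:L} <= fixedSpace (a ^+ t)%g)%VS by rewrite zsE (subvP fixL) ?memvf.
  rewrite -defL -[X in (_ <= X)%VS]subfield_closed agenvS // subv_add sub1v.
  by apply/span_subvP => z; rewrite zsE.
have := card_vspace (fullv : {vspace finvect_type L}).
have -> : #|(fullv : {vspace finvect_type L})| = size zs.
  rewrite -(card_uniqP (uniq_zs : uniq (zs : seq (finvect_type L)))).
  by apply: eq_card => x; rewrite memvf; apply/esym/zsL.
have -> : size zs = m.
  by apply: succn_inj; rewrite -(size_prod_XsubC _ id) -(eqp_size DqL) size_q.
by move/eqP; rewrite eqn_exp2l ?finNzRing_gt1 // => /eqP.
Qed.

(** * Spread sets of matrices from extension fields *)

Section SpreadSet.
Import passmx.

(** Multiplication by an element of the extension field of degree [t] is a matrix over [F]. The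
    difference of two such matrices is multiplication by a nonzero element, hence invertible. *)
Lemma spread_set_exists (F : finFieldType) (t : nat) : (0 < t)%N ->
  exists2 M : {set 'M[F]_t}, #|M| = (#|F| ^ t)%N
    & {in M &, forall A B, A != B -> A - B \in unitmx}.
Proof.
move=> /(finField_ext_exists F)[L dimL]; rewrite -dimL.
pose e := vbasis {:L}; have eP : basis_of {:L} e := vbasisP _.
pose m (a : L) := mxof e e (amull a).
have m_unit a : a != 0 -> m a \in unitmx.
  move=> a_neq0; have : m a *m m a^-1 = 1%:M.
    rewrite -mxof_comp //.
    have -> : (amull (a^-1)%R \o amull a = \1)%VF.
      by apply/lfunP=> x; rewrite !lfunE /= !lfunE /= mulKf.
    by rewrite mxof1 ?(basis_free eP).
  by case/mulmx1_unit.
have mB a b : m a - m b = m (a - b) by rewrite /m -linearB -linearB.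
have m_inj : injective m.
  move=> a b /eqP; rewrite -subr_eq0 mB mxof_eq0 // => /eqP mab.
  apply/eqP; rewrite -subr_eq0 -[_ - _]mulr1.
  by have /lfunP/(_ 1) := mab; rewrite !lfunE /= => ->.
exists ((m : finvect_type L -> _) @: setT).
  rewrite card_imset // cardsT -(card_vspace (fullv : {vspace finvect_type L})).
  by apply: eq_card => x; rewrite memvf.
move=> _ _ /imsetP[a _ ->] /imsetP[b _ ->] neq_ab.
by rewrite mB m_unit // subr_eq0; apply: contraNneq neq_ab => ->.
Qed.

End SpreadSet.

(** * Counting ordered tuples independent modulo a subspace *)

Section MatrixFrames.
Variables (F : finFieldType) (N : nat).
Let q : rat := #|F|%:R.

(** The rank condition says that the [j] rows of [X] are linearly independent modulo [A]. *)
Definition mx_frames m1 m2 (A : 'M[F]_(m1, N)) (U : 'M[F]_(m2, N)) (j : nat) :=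
  [set X : 'M[F]_(j, N) | (X <= U)%MS && (\rank (A + X) == \rank A + j)%N].

Lemma rank_adds_row m (A : 'M[F]_(m, N)) (x : 'rV[F]_N) :
  \rank (A + x) = (\rank A + ~~ (x <= A)%MS)%N.
Proof.
have [xA|xNA] /= := boolP (x <= A)%MS; first by rewrite (addsmx_idPl xA) addn0.
apply/eqP; rewrite eqn_leq addn1 rank_ltmx; last first.
  by rewrite ltmxE addsmxSl addsmx_sub submx_refl.
have := rank_leq_row x; have [le_rk _] := mxrank_adds_leqif A x; lia.
Qed.

Lemma mem_mx_frames_col m1 m2 (A : 'M[F]_(m1, N)) (U : 'M[F]_(m2, N)) j
    (x : 'rV[F]_N) (X : 'M[F]_(j, N)) :
  (col_mx x X \in mx_frames A U (1 + j)) =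
  [&& (x <= U)%MS, ~~ (x <= A)%MS & X \in mx_frames (A + x)%MS U j].
Proof.
have rankD : \rank (A + col_mx x X) = \rank ((A + x) + X).
  by rewrite -addsmxA; apply: eqmx_rank; apply/eqmxP/adds_eqmx/eqmx_sym/addsmxE.
rewrite !inE col_mx_sub rankD -!andbA; congr (_ && _).
have [xA|xNA] /= := boolP (x <= A)%MS; last first.
  by rewrite rank_adds_row xNA addnAC addnS addn1.
apply/negP=> /andP[_ /eqP rkX].
have [le_rk _] := mxrank_adds_leqif (A + x)%MS X.
move: le_rk; rewrite rkX rank_adds_row xA; have := rank_leq_row X; lia.
Qed.

Lemma card_mx_frames_rec m1 m2 (A : 'M[F]_(m1, N)) (U : 'M[F]_(m2, N)) j :
  #|mx_frames A U (1 + j)| =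
  (\sum_(x : 'rV[F]_N | (x <= U)%MS && ~~ (x <= A)%MS) #|mx_frames (A + x)%MS U j|)%N.
Proof.
rewrite -sum1_card (partition_big (fun X : 'M[F]_(1 + j, N) => usubmx X)
  (fun x : 'rV[F]_N => (x <= U)%MS && ~~ (x <= A)%MS)) /=; last first.
  by move=> X; rewrite -{1}(vsubmxK (X : 'M_(1 + j, N))) mem_mx_frames_col andbA => /andP[].
apply: eq_bigr => x /andP[xU xNA].
rewrite sum1_card -[RHS](card_imset _ (f := col_mx x)); last first.
  by move=> X Y /(congr1 dsubmx); rewrite !col_mxKd.
apply: eq_card => X; apply/andP/imsetP => [[XS /eqP defx]|[Y YS ->]].
  exists (dsubmx (X : 'M_(1 + j, N))); last by rewrite -defx vsubmxK.
  by move: XS; rewrite -{1}(vsubmxK (X : 'M_(1 + j, N))) mem_mx_frames_col defx => /and3P[].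
by rewrite mem_mx_frames_col xU xNA YS col_mxKu eqxx.
Qed.

Lemma card_mx_diff m1 m2 (A : 'M[F]_(m1, N)) (U : 'M[F]_(m2, N)) : (A <= U)%MS ->
  #|[pred x : 'rV[F]_N | (x <= U)%MS && ~~ (x <= A)%MS]|%:R
    = q ^+ \rank U - q ^+ \rank A :> rat.
Proof.
move=> AU; rewrite -!natrX -!card_rowg -natrB; last by rewrite subset_leq_card ?rowgS.
rewrite -[in RHS](setIidPr (_ : rowg A \subset rowg U)) ?rowgS // -cardsD.
by congr _%:R; apply: eq_card => x; rewrite !inE andbC.
Qed.

(** The first row is any vector of [U] outside [A], and the others are independent modulo [A + x];
    hence the induction on [j] with [A] varying. *)
Lemma card_mx_frames m1 m2 (A : 'M[F]_(m1, N)) (U : 'M[F]_(m2, N)) j : (A <= U)%MS ->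
  #|mx_frames A U j|%:R = \prod_(i < j) (q ^+ \rank U - q ^+ (\rank A + i)) :> rat.
Proof.
elim: j m1 A => [|j IHj] m1 A AU.
  rewrite big_ord0 (_ : mx_frames A U 0 = setT) ?cardsT ?card_mx ?mul0n //.
  by apply/setP=> X; rewrite !inE flatmx0 sub0mx addsmx0 addn0 eqxx.
rewrite (card_mx_frames_rec A U j) natr_sum.
under eq_bigr => x /andP[xU xNA].
  rewrite IHj ?addsmx_sub ?AU //.
  have -> : \rank (A + x) = (\rank A).+1. by rewrite rank_adds_row xNA addn1.
  under eq_bigr do rewrite addSnnS.
  over.
by rewrite sumr_const -mulr_natl card_mx_diff // big_ord_recl addn0.
Qed.
End MatrixFrames.

(** * Counting intermediate subspaces and complements *)

Section Frames.
Import VectorInternalTheory.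
Variables (F : finFieldType) (vT : vectType F).
Implicit Types A B T U : {vspace vT}.
Let q : rat := #|F|%:R.

Definition frames A U (j : nat) :=
  [set X : 'M[F]_(j, dim vT) |
    (mx2vs X <= U)%VS && (\dim (A + mx2vs X) == \dim A + j)%N].

Lemma card_frames A U j : (A <= U)%VS ->
  #|frames A U j|%:R = \prod_(i < j) (q ^+ \dim U - q ^+ (\dim A + i)) :> rat.
Proof.
move=> AU; rewrite -(card_mx_frames _ (A := vs2mx A) (U := vs2mx U)) //.
congr _%:R; apply: eq_card => X; rewrite !inE /subsetv /dimv.
by rewrite /subsetv mx2vsK /addv mx2vsK (adds_eqmx (eqmx_refl _) (mx2vsK X)).
Qed.

Lemma card_order_gt1 : 1 < q.
Proof. by rewrite ltr1n finNzRing_gt1. Qed.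

Lemma qprod_neq0 (a m j : nat) : (a + j <= m)%N ->
  \prod_(i < j) (q ^+ m - q ^+ (a + i)) != 0.
Proof.
move=> le_ajm; apply/prodf_neq0 => i _.
by rewrite subr_eq0 gt_eqF // ltr_eXn2l ?card_order_gt1 //; have := ltn_ord i; lia.
Qed.

Definition between A U (j : nat) :=
  [set T | [&& (A <= T)%VS, (T <= U)%VS & \dim T == (\dim A + j)%N]].

(** The frames of [U] over [A] are sorted by the space [T] that they span together with [A]; every
    [T] receives equally many. *)
Lemma card_between A U j : (A <= U)%VS ->
  #|between A U j|%:R * \prod_(i < j) (q ^+ (\dim A + j) - q ^+ (\dim A + i))
    = \prod_(i < j) (q ^+ \dim U - q ^+ (\dim A + i)) :> rat.
Proof.
move=> AU; rewrite -card_frames // -[X in _ = X%:R]sum1_card.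
rewrite (partition_big (fun X => A + mx2vs X)%VS (fun T => T \in between A U j)) /=; last first.
  by move=> X; rewrite !inE addvSl subv_add AU.
rewrite natr_sum [RHS](eq_bigr (fun=> \prod_(i < j)
  (q ^+ (\dim A + j) - q ^+ (\dim A + i)))); first by rewrite sumr_const mulr_natl.
move=> T; rewrite inE => /and3P[AT TU /eqP dimT]; rewrite sum1_card -dimT -card_frames //.
congr _%:R; apply: eq_card => X; rewrite unfold_in !inE.
apply/andP/andP => [[/andP[XU dX] /eqP <-]|[XT dX]]; first by rewrite addvSr dX.
rewrite (subv_trans XT TU) dX; split=> //.
by rewrite eqEdim subv_add AT XT (eqP dX) dimT /=.
Qed.

Definition complements A U :=
  [set B | [&& (B <= U)%VS, (A :&: B == 0)%VS & (A + B == U)%VS]].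

(** Every frame of [U] over [A] with [j] rows spans a complement, and every complement is spanned by
    as many frames as it has ordered bases. Pulling [q ^+ \dim A] out of each of the [j] factors
    leaves exactly that number of bases. *)
Lemma card_complements A U : (A <= U)%VS ->
  #|complements A U| = (#|F| ^ (\dim A * (\dim U - \dim A)))%N.
Proof.
move=> AU; set j := (\dim U - \dim A)%N.
have dimU : \dim U = (\dim A + j)%N by rewrite subnKC // dimvS.
have frame_compl X : X \in frames A U j -> mx2vs X \in complements A U.
  rewrite !inE => /andP[XU /eqP dX]; rewrite XU /=.
  have -> : (A + mx2vs X == U)%VS by rewrite eqEdim subv_add AU XU dX dimU /=.
  rewrite andbT -dimv_eq0; have := dimv_sum_cap A (mx2vs X); rewrite dX.
  have : (\dim (mx2vs X) <= j)%N by rewrite /dimv mx2vsK rank_leq_row.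
  by lia.
have : #|complements A U|%:R * \prod_(i < j) (q ^+ j - q ^+ (0 + i)) =
   q ^+ (\dim A * j) * \prod_(i < j) (q ^+ j - q ^+ (0 + i)).
  have -> : q ^+ (\dim A * j) * \prod_(i < j) (q ^+ j - q ^+ (0 + i)) =
     \prod_(i < j) (q ^+ \dim U - q ^+ (\dim A + i)).
    rewrite exprM -[X in _ ^+ X]card_ord -prodr_const -big_split /=.
    by apply: eq_bigr => i _; rewrite dimU !exprD; ring.
  rewrite -card_frames // -[X in _ = X%:R]sum1_card.
  rewrite (partition_big (fun X => mx2vs X) (fun B => B \in complements A U)) /=; last first.
    exact: frame_compl.
  rewrite natr_sum [RHS](eq_bigr (fun=> \prod_(i < j) (q ^+ j - q ^+ (0 + i)))).
    by rewrite sumr_const mulr_natl.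
  move=> B; rewrite inE => /and3P[BU AB0 ABU].
  have dimB : \dim B = j.
    by have := dimv_disjoint_sum (eqP AB0); rewrite (eqP ABU) dimU => /addnI.
  rewrite sum1_card; have := card_frames j (sub0v B); rewrite dimv0 dimB => <-.
  congr _%:R; apply: eq_card => X; rewrite unfold_in !inE dimv0 add0v add0n.
  apply/andP/andP => [[/andP[XU dX] /eqP XB]|[XB dX]]; first by rewrite XB subvv dimB.
  have -> : mx2vs X = B by apply/eqP; rewrite eqEdim XB (eqP dX) dimB /=.
  by rewrite BU (eqP ABU) dimU !eqxx.
move/mulIf => /(_ (qprod_neq0 _)) => /(_ (leqnn _)).
by rewrite -natrX => /eqP; rewrite eqr_nat => /eqP.
Qed.

End Frames.

(** * Identities and estimates for Gaussian binomials *)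

Section Gauss.
Variables (p : nat) (p_gt1 : (1 < p)%N).
Let q : rat := p%:R.
Local Notation g := (gauss_binom p).

Let q_gt1 : 1 < q. Proof. by rewrite ltr1n. Qed.
Let q_gt0 : 0 < q. Proof. exact: lt_trans q_gt1. Qed.
Let q_ge2 : 2 <= q. Proof. by rewrite (ler_nat _ 2). Qed.

Lemma exprB1_gt0 n : (0 < n)%N -> 0 < q ^+ n - 1.
Proof. by move=> n_gt0; rewrite subr_gt0 exprn_egt1 // -lt0n. Qed.

Lemma exprB1_neq0 n : (0 < n)%N -> q ^+ n - 1 != 0.
Proof. by move=> n_gt0; rewrite gt_eqF // exprB1_gt0. Qed.

Lemma gauss_binomE m k :
  g m k = (\prod_(i < k) (q ^+ (m - i) - 1)) / \prod_(i < k) (q ^+ i.+1 - 1).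
Proof.
rewrite /gauss_binom prodf_div; congr (_ / _).
rewrite [RHS](reindex_inj rev_ord_inj) /=; apply: eq_bigr => i _.
by rewrite subnSK.
Qed.

Lemma gauss_binom_gt0 m k : (k <= m)%N -> 0 < g m k.
Proof.
move=> km; apply: prodr_gt0 => i _; have := ltn_ord i => ik.
by rewrite divr_gt0 ?exprB1_gt0 //; lia.
Qed.

Lemma gauss_binomkk k : g k k = 1.
Proof.
rewrite /gauss_binom big1 // => i _; rewrite divff // exprB1_neq0 //.
by have := ltn_ord i; lia.
Qed.

Lemma gauss_binom_recr m k :
  g m k.+1 * (q ^+ k.+1 - 1) = g m k * (q ^+ (m - k) - 1).
Proof.
rewrite !gauss_binomE !big_ord_recr /= invfM.
have := exprB1_neq0 (ltn0Sn k); set d := _ ^+ _.+1 - 1 => d_neq0.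
by rewrite mulrA mulfVK // mulrAC.
Qed.

Lemma gauss_binom_pred m k : (k <= m)%N ->
  g m.+1 k * (q ^+ (m.+1 - k) - 1) = g m k * (q ^+ m.+1 - 1).
Proof.
move=> km; rewrite !gauss_binomE mulrAC [RHS]mulrAC; congr (_ / _).
transitivity (\prod_(i < k.+1) (q ^+ (m.+1 - i)%N - 1)); first by rewrite big_ord_recr.
by rewrite big_ord_recl /= subn0 mulrC.
Qed.

Lemma gauss_binom_hyper k : g k.+1 k * (q - 1) = q ^+ k.+1 - 1.
Proof. by have := gauss_binom_pred (leqnn k); rewrite gauss_binomkk mul1r subSnn. Qed.

(** The factor q^t + 1 is the size of a spread of t-spaces in a 2t-space, so this turns the spread
    bound on intersecting families into [g (2 * t - 1) t]. *)
Lemma gauss_binom_double t : (0 < t)%N -> g (2 * t) t = g (2 * t - 1) t * (q ^+ t + 1).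
Proof.
move=> t_gt0; have e2t : (2 * t - 1).+1 = (2 * t)%N by lia.
have /gauss_binom_pred : (t <= 2 * t - 1)%N by lia.
rewrite e2t => /(congr1 (fun x => x / (q ^+ t - 1))).
have -> : (2 * t - t = t)%N by lia.
rewrite mulfK ?exprB1_neq0 // => ->.
rewrite mulnC exprM -mulrA; congr (_ * _).
by have := exprB1_neq0 t_gt0 => ?; field.
Qed.

(** After multiplication by q^t + 1 the left side is [g (2 * t) t]. Its first factor equals q^t + 1,
    and each of the other t - 1 factors is at most q^(t+1). *)
Lemma gauss_binom_mid_ub t : (0 < t)%N ->
  g (2 * t - 1) t <= q ^+ ((t + 1) * (t - 1)).
Proof.
case: t => // t _; rewrite -(ler_pM2r (_ : 0 < q ^+ t.+1 + 1)); last first.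
  by rewrite addr_gt0 ?exprn_gt0.
rewrite -gauss_binom_double // /gauss_binom big_ord_recl /= !subn0 mulrC.
apply: ler_pM.
- apply: prodr_ge0 => i _; have := ltn_ord i => ik.
  by rewrite ltW // divr_gt0 ?exprB1_gt0 // /bump /=; lia.
- by rewrite divr_ge0 // ltW ?exprB1_gt0.
- rewrite subn1 /= exprM -[X in _ ^+ X](card_ord t) -prodr_const.
  apply: ler_prod => i _; have ik := ltn_ord i; rewrite /bump /= !add1n.
  have -> : (2 * t.+1 - i.+1 = (t.+1 - i.+1) + t.+1)%N by lia.
  have : (0 < t.+1 - i.+1)%N by lia.
  case: (t.+1 - i.+1)%N => // a _.
  rewrite ltW ?divr_gt0 ?exprB1_gt0 // ler_pdivrMr ?exprB1_gt0 //.
  rewrite addn1 exprD !exprS.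
  have x_ge1 : 1 <= q ^+ a by rewrite exprn_ege1 // ltW.
  have y_ge1 : 1 <= q ^+ t by rewrite exprn_ege1 // ltW.
  have x1 : 0 <= q ^+ a * (q - 1) - 1 by rewrite subr_ge0 mulr_ege1 // lerBrDl.
  have := mulr_ge0 (mulr_ge0 (ltW q_gt0) (ltW q_gt0)) (mulr_ge0 (ltW (exprn_gt0 t q_gt0)) x1).
  lra.
- by rewrite mulnC exprM ler_pdivrMr ?exprB1_gt0 // mulrC -subr_sqr_1.
Qed.

End Gauss.

(** * Double counting and the number of subspaces *)

Lemma double_count (I J : finType) (A : {set I}) (B : {set J}) (r : I -> J -> bool) :
  (\sum_(i in A) #|[set j in B | r i j]| = \sum_(j in B) #|[set i in A | r i j]|)%N.
Proof.
transitivity (\sum_(i in A) \sum_(j in B | r i j) 1)%N.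
  by apply: eq_bigr => i _; rewrite sum1_card; apply: eq_card => j; rewrite inE.
rewrite (exchange_big_dep (mem B)) //=; last by move=> i j _ /andP[].
apply: eq_bigr => j jB; rewrite sum1_card; apply: eq_card => i.
by rewrite unfold_in !inE jB.
Qed.

Section Counting.
Variables (F : finFieldType) (vT : vectType F).
Implicit Types A B T U : {vspace vT}.
Let q : rat := #|F|%:R.
Local Notation g := (gauss_binom #|F|).

Lemma card_subspaces_of_dim U k : (k <= \dim U)%N ->
  #|subspaces_of_dim U k|%:R = g (\dim U) k.
Proof.
move=> kU; have := card_between k (sub0v U); rewrite dimv0 add0n => cardB.
have -> : subspaces_of_dim U k = between 0 U k.
  by apply/setP=> T; rewrite !inE sub0v dimv0.
have nz := @qprod_neq0 F 0 k k (leqnn _).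
apply: (mulIf nz); rewrite cardB /gauss_binom -big_split /=.
apply: eq_bigr => i _; rewrite add0n; have ik := ltn_ord i.
have fE m : (i <= m)%N -> q ^+ m - q ^+ i = (q ^+ (m - i) - 1) * q ^+ i.
  by move=> im; rewrite mulrBl mul1r -exprD subnK.
rewrite -/q !fE ?(leq_trans _ kU) ?(ltnW ik) //.
by rewrite mulrA divfK // exprB1_neq0 ?subn_gt0 ?finNzRing_gt1.
Qed.

Lemma card_between1 A U : (A <= U)%VS ->
  #|between A U 1|%:R = (q ^+ \dim U - q ^+ \dim A) / (q ^+ (\dim A).+1 - q ^+ \dim A).
Proof.
move=> AU; have := card_between 1 AU; have := @qprod_neq0 F (\dim A) (\dim A + 1) 1 (leqnn _).
by rewrite !big_ord1 addn0 addn1 => nz eq1; rewrite -eq1 mulfK.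
Qed.

End Counting.

(** * Intersecting families of t-spaces in a 2t-space *)

Section EKR.
Import VectorInternalTheory.
Variables (F : finFieldType) (vT : vectType F).
Implicit Types A B T U : {vspace vT}.
Let q : rat := #|F|%:R.
Local Notation g := (gauss_binom #|F|).

Lemma mx2vs_sub m (X : 'M[F]_(m, dim vT)) U : (mx2vs X <= U)%VS = (X <= vs2mx U)%MS.
Proof. by rewrite /subsetv mx2vsK. Qed.

(** The count does not depend on [T]: a basis of [T] is chosen, then completed to a basis of [U]. *)
Lemma card_basis_pairs t U T : \dim U = (2 * t)%N -> T \in subspaces_of_dim U t ->
  #|[set X : 'M[F]_(t, dim vT) * 'M[F]_(t, dim vT) |
      (mx2vs X.1 + mx2vs X.2 == U)%VS && (mx2vs X.1 == T)]|%:R =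
  \prod_(i < t) (q ^+ t - q ^+ (0 + i)) * \prod_(i < t) (q ^+ (2 * t) - q ^+ (t + i)).
Proof.
move=> dimU; rewrite inE => /andP[TU /eqP dimT].
have := card_frames t (sub0v T); have := card_frames t TU.
rewrite dimv0 dimU dimT => <- <-; rewrite -natrM -cardsX.
congr _%:R; apply: eq_card => -[X Y]; rewrite !inE /= dimv0 !add0v dimT.
apply/andP/andP => [[/eqP XYU /eqP XT]|[/andP[XT /eqP dX] /andP[YU /eqP dXY]]].
  have -> : (T + mx2vs Y = U)%VS by rewrite -XT.
  by rewrite XT subvv dimT dimU addnn mul2n !eqxx -XYU addvSr.
have -> : mx2vs X = T by apply/eqP; rewrite eqEdim XT dX dimT /=.
by rewrite eqEdim subv_add TU YU dXY dimU eqxx /=; split=> //; lia.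
Qed.

(* The images of a Desarguesian spread cover all t-subspaces of U equally often,
   and an intersecting family contains at most one of the q^t + 1 members of each
   of them. *)
Lemma intersecting_card_ub t U (N : {set {vspace vT}}) :
  (0 < t)%N -> \dim U = (2 * t)%N -> N \subset subspaces_of_dim U t ->
  {in N &, forall A B, (A + B)%VS != U} ->
  #|N|%:R * (q ^+ t + 1) <= g (2 * t) t.
Proof.
move=> t_gt0 dimU NU crossN.
have [M cardM unitM] := spread_set_exists F t_gt0.
pose pair := ('M[F]_(t, dim vT) * 'M[F]_(t, dim vT))%type.
pose bases := [set X : pair | mx2vs X.1 + mx2vs X.2 == U]%VS.
(* For a basis (X1, X2) of U, the row spaces of X1 + A X2 with A in M, together
   with that of X2, form a spread. *)
pose act (s : option 'M[F]_t) (X : pair) : pair :=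
  if s is Some A then (X.1 + A *m X.2, X.2) else (X.2, X.1).
pose beta : rat := \prod_(i < t) (q ^+ t - q ^+ (0 + i)) *
  \prod_(i < t) (q ^+ (2 * t) - q ^+ (t + i)).
have q_gt1 : 1 < q := card_order_gt1 F.
have beta_gt0 : 0 < beta.
  apply: mulr_gt0; apply: prodr_gt0 => i _; rewrite subr_gt0 ltr_eXn2l //;
    by have := ltn_ord i; lia.
have card_in (S : {set {vspace vT}}) : S \subset subspaces_of_dim U t ->
    #|[set X in bases | mx2vs X.1 \in S]|%:R = #|S|%:R * beta.
  move=> SU; rewrite -sum1_card (partition_big (fun X : pair => mx2vs X.1) (fun T => T \in S)) /=.
    rewrite natr_sum (eq_bigr (fun=> beta)) ?sumr_const ?mulr_natl // => T TS.
    rewrite sum1_card; have := card_basis_pairs dimU (subsetP SU _ TS).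
    rewrite -/beta => <-; congr _%:R.
    apply: eq_card => X; rewrite unfold_in !inE -andbA; congr (_ && _).
    by apply: andb_idl => /eqP ->.
  by move=> X; rewrite !inE => /andP[].
have act_inj s : injective (act s).
  case: s => [A|] [X Y] [X' Y'] /= []; last by move=> -> ->.
  by move=> + eqY; rewrite eqY => /addIr ->.
have act_bases s X : (act s X \in bases) = (X \in bases).
  case: s X => [A|] [X Y]; rewrite !inE /=; last by rewrite addvC.
  congr (_ == _); apply/eqP; rewrite eqEsubv !subv_add !addvSr !andbT !mx2vs_sub.
  have XYl : (X <= vs2mx (mx2vs X + mx2vs Y)%VS)%MS by rewrite -mx2vs_sub addvSl.
  have XYr : (Y <= vs2mx (mx2vs X + mx2vs Y)%VS)%MS by rewrite -mx2vs_sub addvSr.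
  set W := (mx2vs (X + A *m Y)%R + mx2vs Y)%VS; set W' := (mx2vs X + mx2vs Y)%VS.
  have Wl : ((X + A *m Y)%R <= vs2mx W)%MS by rewrite -mx2vs_sub /W addvSl.
  have Wr : (Y <= vs2mx W)%MS by rewrite -mx2vs_sub /W addvSr.
  have Xl : (X <= vs2mx W)%MS.
    by rewrite -[X](addrK (A *m Y)) addmx_sub ?eqmx_opp ?mulmx_sub.
  by rewrite Xl andbT addmx_sub ?mulmx_sub.
(* The rows of X1 + A X2 and X1 + B X2 differ by those of (A - B) X2. As A - B is invertible, the
   sum of the two row spaces contains X2, and then X1. *)
have act_meet s s' X : X \in bases -> s \in None |: (Some @: M) -> s' \in None |: (Some @: M) ->
    s != s' -> (mx2vs (act s X).1 + mx2vs (act s' X).1)%VS = U.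
  move=> XB sM s'M neq_ss'; apply/eqP; rewrite eqEsubv; apply/andP; split.
    have sub_U r : (mx2vs (act r X).1 <= U)%VS.
      by have := XB; rewrite -(act_bases r) inE => /eqP <-; rewrite addvSl.
    by rewrite subv_add !sub_U.
  set W := (mx2vs (act s X).1 + mx2vs (act s' X).1)%VS; move: XB; rewrite inE => /eqP <-.
  have Wl : ((act s X).1 <= vs2mx W)%MS by rewrite -mx2vs_sub /W addvSl.
  have Wr : ((act s' X).1 <= vs2mx W)%MS by rewrite -mx2vs_sub /W addvSr.
  clearbody W; have X2W : (X.2 <= vs2mx W)%MS.
    case: s s' sM s'M neq_ss' Wl Wr => [A|] [B|] //= sM s'M neq_AB Wl Wr.
    have AB : A - B \in unitmx.
      move: sM s'M; rewrite !inE /= => /imsetP[A' A'M [eqA]] /imsetP[B' B'M [eqB]].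
      by apply: unitM; rewrite ?eqA ?eqB //; apply: contraNneq neq_AB; rewrite eqA eqB => ->.
    rewrite -[X.2](mulKmx AB) mulmx_sub // mulmxBl.
    have -> : A *m X.2 - B *m X.2 = (X.1 + A *m X.2) - (X.1 + B *m X.2).
      by rewrite opprD addrACA subrr add0r.
    by rewrite addmx_sub ?eqmx_opp.
  rewrite subv_add !mx2vs_sub X2W andbT.
  have X1E (A : 'M[F]_t) : X.1 = X.1 + A *m X.2 - A *m X.2 by rewrite addrK.
  case: s s' {sM s'M} neq_ss' Wl Wr X2W => [A|] [B|] //= _ Wl Wr X2W.
  - by rewrite (X1E A) addmx_sub ?eqmx_opp ?mulmx_sub.
  - by rewrite (X1E A) addmx_sub ?eqmx_opp ?mulmx_sub.
  - by rewrite (X1E B) addmx_sub ?eqmx_opp ?mulmx_sub.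
(* Counted are the pairs of a spread index [s] and a basis [X] whose spread member lies in [N]. Each
   of the q^t + 1 indices gives [#|N| * beta] pairs, since [act s] permutes the bases; each basis
   gives at most one, since distinct members of a spread sum to [U]. *)
have := double_count (None |: (Some @: M)) bases (fun s X => mx2vs (act s X).1 \in N).
move/(congr1 (fun n => n%:R : rat)); rewrite !natr_sum => dc.
rewrite -(ler_pM2r beta_gt0).
have -> : g (2 * t) t * beta = #|bases|%:R.
  rewrite -dimU -card_subspaces_of_dim -?card_in //; last lia.
  congr _%:R; apply: eq_card => X; rewrite !inE; apply: andb_idr => /eqP XU.
  rewrite -[X in (_ <= X)%VS]XU addvSl /=; have := dimv_add_leqif (mx2vs X.1) (mx2vs X.2).
  rewrite XU dimU => -[le_dim _].
  have rkX (Y : 'M[F]_(t, dim vT)) : (\dim (mx2vs Y) <= t)%N.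
    by rewrite /dimv mx2vsK rank_leq_row.
  rewrite eqn_leq rkX /= -(leq_add2r (\dim (mx2vs X.2))).
  by apply: leq_trans le_dim; rewrite mul2n -addnn leq_add2l rkX.
rewrite [X in X <= _](_ : _ = \sum_(s in None |: Some @: M)
  #|[set X in bases | mx2vs (act s X).1 \in N]|%:R); last first.
  rewrite (eq_bigr (fun=> #|N|%:R * beta)).
    rewrite sumr_const cardsU1 card_imset; last by move=> ? ? [].
    rewrite cardM -[RHS]mulr_natr natrD natrX.
    have -> : None \notin Some @: M by apply/imsetP => -[].
    by rewrite -/q addrC mulrAC.
  move=> s _; rewrite -card_in //; congr _%:R.
  rewrite -(card_imset _ (act_inj s)).
  have [act' actK actK'] : bijective (act s) by apply: injF_bij.
  apply: eq_card => X; apply/imsetP/setIdP => [[Y /setIdP[YB YN] ->]|[XB XN]].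
    by rewrite act_bases.
  by exists (act' X); rewrite ?actK' // ; apply/setIdP; rewrite -(act_bases s) actK'.
rewrite dc -sum1_card natr_sum; apply: ler_sum => X XB.
rewrite ler_nat; apply/card_le1_eqP => s s' /setIdP[sM sN] /setIdP[s'M s'N].
apply/eqP; apply: contraT => ss'; case/eqP: (crossN _ _ sN s'N).
by apply: act_meet => //; rewrite eq_sym.
Qed.
End EKR.

(** * Owned, heavy and uncovered subspaces *)

Section Degree.
Variables (F : finFieldType) (vT : vectType F) (FF : {set {vspace vT}}).
Implicit Types A B T U H : {vspace vT}.
Let q : rat := #|F|%:R.
Local Notation g := (gauss_binom #|F|).
Local Notation V := (fullv : {vspace vT}).

Definition deg T : nat := #|[set H in FF | (T <= H)%VS]|.
Definition own (j : nat) U := [set T in subspaces_of_dim U j | deg T == 1]%N.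
Definition heavy (j : nat) U := [set T in subspaces_of_dim U j | 1 < deg T]%N.
Definition uncovered (j : nat) := [set T in subspaces_of_dim V j | deg T == 0]%N.

Lemma mem_subspaces U j T : (T \in subspaces_of_dim U j) = (T <= U)%VS && (\dim T == j).
Proof. by rewrite inE. Qed.

Lemma mem_own j U T : (T \in own j U) = [&& (T <= U)%VS, \dim T == j & deg T == 1%N].
Proof. by rewrite !inE andbA. Qed.

Lemma mem_heavy j U T : (T \in heavy j U) = [&& (T <= U)%VS, \dim T == j & (1 < deg T)%N].
Proof. by rewrite !inE andbA. Qed.

Lemma mem_uncovered j T : (T \in uncovered j) = (\dim T == j) && (deg T == 0%N).
Proof. by rewrite !inE subvf. Qed.

Lemma deg_gt0 T H : H \in FF -> (T <= H)%VS -> (0 < deg T)%N.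
Proof. by move=> HF TH; rewrite /deg (cardD1 H) inE HF TH. Qed.

Lemma deg_gt1 T H H' : H \in FF -> H' \in FF -> H != H' -> (T <= H)%VS -> (T <= H')%VS ->
  (1 < deg T)%N.
Proof.
move=> HF H'F neqH TH TH'; rewrite /deg (cardD1 H) (cardD1 H') !inE HF TH H'F TH'.
by rewrite eq_sym neqH.
Qed.

Lemma deg1_inj T H H' : deg T = 1%N -> H \in FF -> H' \in FF ->
  (T <= H)%VS -> (T <= H')%VS -> H = H'.
Proof.
move=> dT HF H'F TH TH'; apply/eqP; apply: contraT => neqH.
by have := deg_gt1 HF H'F neqH TH TH'; rewrite dT.
Qed.

Lemma deg_gt0P T : reflect (exists2 H, H \in FF & (T <= H)%VS) (0 < deg T)%N.
Proof.
apply: (iffP idP) => [|[H HF TH]]; last exact: deg_gt0 HF TH.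
by rewrite /deg card_gt0 => /set0Pn[H]; rewrite inE => /andP[]; exists H.
Qed.

Lemma deg_gt1_other T H : (1 < deg T)%N -> H \in FF ->
  exists H', [/\ H' \in FF, H' != H & (T <= H')%VS].
Proof.
move=> dT HF; have : (0 < #|[set H in FF | (T <= H)%VS] :\ H|)%N.
  by move: dT; rewrite /deg (cardsD1 H); case: (_ \in _); rewrite ?add0n // => /ltnW.
by rewrite card_gt0 => /set0Pn[H']; rewrite !inE => /and3P[]; exists H'.
Qed.

Lemma card_own_heavy j H : H \in FF ->
  (#|own j H| + #|heavy j H| = #|subspaces_of_dim H j|)%N.
Proof.
move=> HF; rewrite -(cardsID [set T | deg T == 1%N] (subspaces_of_dim H j)); congr (_ + _)%N.
  by apply: eq_card => T; rewrite !inE.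
apply: eq_card => T; rewrite !inE andbC; apply: andb_id2r => /andP[TH _].
by have := deg_gt0 HF TH; case: (deg T) => [|[]].
Qed.

Lemma card_deg_partition j :
  (#|uncovered j| + #|own j V| + #|heavy j V| = #|subspaces_of_dim V j|)%N.
Proof.
rewrite -(cardsID [set T | deg T == 0%N] (subspaces_of_dim V j)) -addnA; congr (_ + _)%N.
  by apply: eq_card => T; rewrite !inE.
rewrite -(cardsID [set T | deg T == 1%N] (_ :\: _)); congr (_ + _)%N; apply: eq_card => T;
  by rewrite !inE; case: (deg T) => [|[|d]] /=; rewrite ?andbT ?andbF.

Qed.

Lemma sum_card_own j : (\sum_(H in FF) #|own j H| = #|own j V|)%N.
Proof.
rewrite -sum1_card; have := double_count FF (own j V) (fun H T => (T <= H)%VS).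
under eq_bigr => H HF.
  have -> : [set T in own j V | (T <= H)%VS] = own j H.
    by apply/setP=> T; rewrite inE !mem_own subvf andbC.
  over.
by move=> ->; apply: eq_bigr => T; rewrite mem_own => /and3P[_ _ /eqP].
Qed.

Lemma sum_card_heavy (P : pred {vspace vT}) j :
  (\sum_(H in FF | P H) #|heavy j H| =
   \sum_(T in heavy j V) #|[set H in FF | P H & (T <= H)%VS]|)%N.
Proof.
have := double_count [set H in FF | P H] (heavy j V) (fun H T => (T <= H)%VS).
under [in RHS]eq_bigr do rewrite setIdE; move=> dc.
transitivity (\sum_(H in [set H in FF | P H]) #|[set T in heavy j V | (T <= H)%VS]|)%N.
  rewrite [RHS](eq_bigl (fun H => (H \in FF) && P H)); last by move=> H; rewrite inE.
  apply: eq_bigr => H _; apply: eq_card => T.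
  by rewrite [RHS]inE !mem_heavy subvf andbC.
rewrite dc; apply: eq_bigr => T _; apply: eq_card => H.
by rewrite !inE andbA.
Qed.

Section Uniform.
Variables (k n : nat).
Hypotheses (FF_sub : FF \subset subspaces_of_dim V k) (dimV : \dim V = n).

Lemma dim_member H : H \in FF -> \dim H = k.
Proof. by move/(subsetP FF_sub); rewrite inE => /andP[_ /eqP]. Qed.

(** If [B] is owned by [H], any member containing a space above [B] is [H], so the (t+1)-spaces
    above [B] not inside [H] are uncovered. An uncovered (t+1)-space has only [g t.+1 t] subspaces
    of dimension [t]. *)
Lemma own_uncovered_le t :
  #|own t V|%:R * ((q ^+ n - q ^+ k) / (q ^+ t.+1 - q ^+ t))
    <= #|uncovered t.+1|%:R * g t.+1 t.
Proof.
have cardB B : B \in own t V -> #|[set T in uncovered t.+1 | (B <= T)%VS]|%:R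
   = (q ^+ n - q ^+ k) / (q ^+ t.+1 - q ^+ t).
  rewrite mem_own => /and3P[_ /eqP dimB /eqP dB].
  have /deg_gt0P[H HF BH] : (0 < deg B)%N by rewrite dB.
  (* The (t+1)-spaces above [B] in the whole space, minus those inside [H]. *)
  have <- : (q ^+ n - q ^+ t) / (q ^+ t.+1 - q ^+ t) - (q ^+ k - q ^+ t) / (q ^+ t.+1 - q ^+ t)
     = (q ^+ n - q ^+ k) / (q ^+ t.+1 - q ^+ t).
    by rewrite -mulrBl opprB addrA subrK.
  have := card_between1 (subvf B); have := card_between1 BH.
  rewrite dimB dimV (dim_member HF) => <- <-.
  have sHV : between B H 1 \subset between B V 1.
    by apply/subsetP=> T; rewrite !inE subvf => /and3P[-> _ ->].
  rewrite -natrB ?subset_leq_card // -[in RHS](setIidPr sHV) -cardsD; congr _%:R.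
  apply: eq_card => T; rewrite in_setD inE mem_uncovered !inE subvf dimB addn1 /=.
  case BT: (B <= T)%VS; rewrite ?andbT ?andbF //= andbC.
  case: (\dim T == t.+1); rewrite ?andbT ?andbF //=.
  apply/idP/idP => [/eqP dT|].
    by apply: contraTN isT => TH; have := deg_gt0 HF TH; rewrite dT.
  apply: contraR; rewrite -lt0n => /deg_gt0P[H' H'F TH'].
  by rewrite (deg1_inj dB HF H'F BH (subv_trans BT TH')).
have := double_count (own t V) (uncovered t.+1) (fun B T => (B <= T)%VS).
move/(congr1 (fun m => m%:R : rat)); rewrite !natr_sum (eq_bigr _ cardB) sumr_const mulr_natl.
move->; rewrite mulr_natl -sumr_const; apply: ler_sum => T.
rewrite mem_uncovered => /andP[/eqP dimT _].
have <- : #|subspaces_of_dim T t|%:R = g t.+1 t by rewrite card_subspaces_of_dim dimT.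
rewrite ler_nat; apply/subset_leq_card/subsetP => B.
by rewrite !inE => /andP[/andP[/andP[_ ->] _] ->].
Qed.

Hypothesis FF_cf : cover_free FF.

(** Let [H1] and [H2] be other members through [A] and [B]. If [A + B] were [H], then [H1] and [H2]
    distinct would contradict cover-freeness, and [H1 = H2] would contain [H], hence equal it by
    dimension. *)
Lemma heavy_sum_neq H A B : H \in FF -> (A <= H)%VS -> (B <= H)%VS ->
  (1 < deg A)%N -> (1 < deg B)%N -> (A + B)%VS != H.
Proof.
move=> HF AH BH dA dB; apply/negP => /eqP ABH.
have [H1 [H1F neq1 AH1]] := deg_gt1_other dA HF.
have [H2 [H2F neq2 BH2]] := deg_gt1_other dB HF.
have [eqH|neq12] := eqVneq H1 H2.
  have HH1 : (H <= H1)%VS by rewrite -ABH subv_add AH1 eqH BH2.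
  by case/negP: neq1; rewrite eq_sym eqEdim HH1 !dim_member /=.
apply: FF_cf; exists H, H1, H2; rewrite ![H == _]eq_sym; split; split=> //.
by rewrite -{1}ABH addvS // subv_cap ?AH ?AH1 ?BH ?BH2.
Qed.

Lemma complement_own a H A B : H \in FF -> (A <= H)%VS -> \dim A = a -> (1 < deg A)%N ->
  B \in complements A H -> B \in own (k - a) H.
Proof.
move=> HF AH dimA dA; rewrite inE mem_own => /and3P[BH AB0 /eqP ABH].
have dimB : \dim B = (k - a)%N.
  have := dimv_disjoint_sum (eqP AB0); rewrite ABH (dim_member HF) dimA => ->.
  by rewrite addKn.
rewrite BH dimB eqxx /= eqn_leq (deg_gt0 HF BH) andbT leqNgt.
apply/negP => dB; have := heavy_sum_neq HF AH BH dA dB.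
by rewrite ABH eqxx.
Qed.

Lemma card_own_ge a H A : H \in FF -> (A <= H)%VS -> \dim A = a -> (1 < deg A)%N ->
  (#|F| ^ (a * (k - a)) <= #|own (k - a) H|)%N.
Proof.
move=> HF AH dimA dA; have := card_complements AH; rewrite dimA (dim_member HF) => <-.
by apply/subset_leq_card/subsetP => B; apply: complement_own dA.
Qed.

(** Complementation in [H] relates heavy a-spaces to owned (k-a)-spaces. Each heavy space has
    q^(a(k-a)) complements, all owned, and each owned space has just as many complements, heavy or
    not. *)
Lemma card_heavy_le_own a H : H \in FF -> (#|heavy a H| <= #|own (k - a) H|)%N.
Proof.
(* For [a] above [k] the difference [k - a] truncates to 0, but then no a-space fits into [H]. *)
move=> HF; have [le_ak|lt_ka] := leqP a k; last first.
  rewrite (_ : heavy a H = set0) ?cards0 //; apply/setP => T; rewrite mem_heavy inE.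
  by apply/negP => /and3P[/dimvS TH /eqP dT _]; move: TH; rewrite dT (dim_member HF) leqNgt lt_ka.
rewrite -(leq_pmul2r (_ : 0 < #|F| ^ (a * (k - a)))%N); last first.
  by rewrite expn_gt0 ltnW ?finNzRing_gt1.
rewrite -!sum_nat_const.
have <- : (\sum_(T in heavy a H)
     #|[set B in own (k - a) H | (T :&: B == 0)%VS && (T + B == H)%VS]| =
   \sum_(T in heavy a H) #|F| ^ (a * (k - a)))%N.
  apply: eq_bigr => T; rewrite mem_heavy => /and3P[TH /eqP dimT dT].
  have := card_complements TH; rewrite dimT (dim_member HF) => <-.
  apply: eq_card => B; rewrite inE; apply/andP/idP => [[]|BC].
    by rewrite mem_own inE => /and3P[-> _ _] ->.
  by rewrite (complement_own HF TH dimT dT BC); move: BC; rewrite inE => /and3P[_ -> ->].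
rewrite double_count; apply: leq_sum => B; rewrite mem_own => /and3P[BH /eqP dimB _].
have := card_complements BH; rewrite dimB (dim_member HF) subKn // mulnC => <-.
apply/subset_leq_card/subsetP => T; rewrite inE mem_heavy inE capvC addvC.
by move=> /andP[/and3P[-> _ _] ->].
Qed.

End Uniform.
End Degree.

Lemma subspace_between_exists (F : finFieldType) (vT : vectType F) (A U : {vspace vT}) j :
  (A <= U)%VS -> (\dim A <= j <= \dim U)%N ->
  exists T, [/\ (A <= T)%VS, (T <= U)%VS & \dim T = j].
Proof.
move=> AU /andP[le_aj le_ju].
have dimC : \dim (U :\: A) = (\dim U - \dim A)%N.
  by have := dimv_cap_compl U A; rewrite (capv_idPr AU) => <-; rewrite addKn.
have : (0 : rat) < #|subspaces_of_dim (U :\: A)%VS (j - \dim A)|%:R.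
  rewrite card_subspaces_of_dim; last by rewrite dimC leq_sub2r.
  by rewrite gauss_binom_gt0 ?finNzRing_gt1 // dimC leq_sub2r.
rewrite ltr0n card_gt0 => /set0Pn[P]; rewrite inE => /andP[PC /eqP dimP].
exists (A + P)%VS; split; first exact: addvSl.
  by rewrite subv_add AU (subv_trans PC) ?diffvSl.
rewrite dimv_disjoint_sum ?dimP ?subnKC //; apply/eqP; rewrite -subv0.
by rewrite -(capv_diff U A) capvC capvS.
Qed.

(** * Upper bounds on the size of the family *)

Section Bounds.
Variables (F : finFieldType) (vT : vectType F) (FF : {set {vspace vT}}).
Implicit Types A B T U H : {vspace vT}.
Let q : rat := #|F|%:R.
Local Notation g := (gauss_binom #|F|).
Local Notation V := (fullv : {vspace vT}).
Local Notation deg := (deg FF).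
Local Notation own := (own FF).
Local Notation heavy := (heavy FF).
Local Notation uncovered := (uncovered FF).

Let q_gt1 : 1 < q. Proof. exact: card_order_gt1. Qed.
Let q_gt0 : 0 < q. Proof. exact: lt_trans q_gt1. Qed.
Let q_ge2 : 2 <= q. Proof. by rewrite (ler_nat _ 2) finNzRing_gt1. Qed.

Variables (k n : nat).
Hypotheses (FF_sub : FF \subset subspaces_of_dim V k) (dimV : \dim V = n).
Hypotheses (FF_cf : cover_free FF) (lt_kn : (k < n)%N).

(** The value [q ^+ s.+1] separates the two sides. On the right, n > k gives at least q^(k-s), and k
    is at least 2s + 1. *)
Lemma hyperplanes_lt s : (2 * s < k)%N ->
  g s.+1 s < (q ^+ n - q ^+ k) / (q ^+ s.+1 - q ^+ s).
Proof.
move=> lt_sk; apply: (@lt_le_trans _ _ (q ^+ s.+1)).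
  have := gauss_binom_hyper (finNzRing_gt1 F) s; rewrite -/q => hyper.
  have g_gt0 : 0 < g s.+1 s by rewrite gauss_binom_gt0 // finNzRing_gt1.
  have : g s.+1 s * 1 <= g s.+1 s * (q - 1).
    by rewrite ler_wpM2l ?(ltW g_gt0) // lerBrDl.
  by rewrite hyper mulr1 => /le_lt_trans -> //; rewrite ltrBlDr ltrDl.
have -> : q ^+ s.+1 - q ^+ s = q ^+ s * (q - 1) by rewrite exprSr; ring.
rewrite ler_pdivlMr ?mulr_gt0 ?exprn_gt0 ?subr_gt0 //.
rewrite mulrA -exprD; apply: (@le_trans _ _ (q ^+ k.+1 - q ^+ k)).
  rewrite (exprSr q k) -[X in _ <= _ - X]mulr1 -mulrBr ler_wpM2r ?subr_ge0 ?(ltW q_gt1) //.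
  by rewrite ler_eXn2l //; lia.
by rewrite lerD2r ler_eXn2l.
Qed.

(** An owned s-space lies in more uncovered (s+1)-spaces than an (s+1)-space has hyperplanes, so
    equality is possible only when both counts vanish. *)
Lemma own_le_uncovered s : (2 * s < k)%N ->
  (#|own s V| <= #|uncovered s.+1| ?= iff (#|uncovered s.+1| == 0))%N.
Proof.
move=> lt_sk; have := own_uncovered_le FF_sub dimV s; have := hyperplanes_lt lt_sk.
set h := g _ _; set e := (_ / _); set a := #|_|; set b := #|_| => lt_he le_ab.
have h_gt0 : 0 < h by rewrite gauss_binom_gt0 // finNzRing_gt1.
have le_ab' : (a <= b)%N.
  rewrite -(ler_nat rat) -(ler_pM2r h_gt0); apply: le_trans le_ab.
  by rewrite ler_wpM2l // ltW.
split=> //; apply/eqP/eqP => [eq_ab|b0]; last first.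
  by apply/eqP; rewrite b0 -leqn0 (leq_trans le_ab') ?b0.
apply/eqP; rewrite -leqn0 leqNgt; apply/negP => b_gt0.
by move: le_ab; rewrite eq_ab ler_pM2l ?ltr0n // leNgt lt_he.
Qed.

(** * Odd member dimension *)

Section OddDimension.
Variable s : nat.
Hypothesis k_odd : k = (2 * s).+1.

(** With t = s + 1, incidences of members with t-spaces are split into owned and heavy ones. The
    heavy incidences number at most the owned s-spaces, hence at most the uncovered t-spaces, so the
    total is bounded by the number of all t-spaces. *)
Lemma odd_family_le :
  (#|FF|%:R * g k s.+1 <= g n s.+1) /\
  (#|FF|%:R * g k s.+1 = g n s.+1 -> forall T, \dim T = s.+1 -> deg T = 1%N).
Proof.
have le_s : (s.+1 <= k)%N by lia.
have Vt : g n s.+1 = #|subspaces_of_dim V s.+1|%:R.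
  by rewrite card_subspaces_of_dim dimV //; lia.
have Ht H : H \in FF -> g k s.+1 = #|subspaces_of_dim H s.+1|%:R.
  by move=> HF; rewrite card_subspaces_of_dim (dim_member FF_sub HF).
have sumH : (#|FF|%:R * g k s.+1 = (\sum_(H in FF) (#|own s.+1 H| + #|heavy s.+1 H|)%N)%:R).
  rewrite natr_sum mulr_natl -sumr_const; apply: eq_bigr => H HF.
  by rewrite (Ht H HF) card_own_heavy.
have le_heavy : (\sum_(H in FF) #|heavy s.+1 H| <= #|own s V|)%N.
  rewrite -sum_card_own; apply: leq_sum => H HF.
  have := card_heavy_le_own FF_sub FF_cf s.+1 HF.
  by rewrite (_ : k - s.+1 = s)%N //; lia.
have lt_2s : (2 * s < k)%N by lia.
have le_unc := own_le_uncovered lt_2s.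
rewrite sumH Vt -(card_deg_partition FF) big_split /= sum_card_own.
rewrite ler_nat addnC -addnA.
have le_hu := leq_trans le_heavy le_unc.
split; first by rewrite leq_add // leq_addr.
move/eqP; rewrite eqr_nat => /eqP eq_card T dimT.
(* Equality leaves no room for heavy t-spaces, and forces equality in [own_le_uncovered], hence no
   uncovered ones either. *)
have [eq_hu heavy0] :
    (\sum_(H in FF) #|heavy s.+1 H| = #|uncovered s.+1|)%N /\ #|heavy s.+1 V| = 0%N.
  move: le_hu eq_card; set a := (\sum_(_ in _) _)%N.
  by set b := #|_|; set c := #|_|; set d := #|_|; clear; lia.
have unc0 : #|uncovered s.+1| = 0%N.
  by apply/eqP; rewrite -le_unc.2 eqn_leq le_unc -eq_hu le_heavy.
have : T \notin uncovered s.+1 by rewrite (cards0_eq unc0) inE.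
have : T \notin heavy s.+1 V by rewrite (cards0_eq heavy0) inE.
rewrite mem_uncovered mem_heavy subvf dimT eqxx /=.
by case: (deg T) => [|[]].
Qed.

End OddDimension.

(** * Even member dimension *)

Section EvenDimension.
Variable s : nat.
Local Notation t := s.+1.
Hypothesis k_even : k = (2 * t)%N.
Local Notation c := (g (2 * t - 1) t).

Definition scattered H := [forall H' in FF, (H' != H) ==> (\dim (H :&: H') <= t)%N].

(** This is (q^(n-t) - 1)/(q^t - 1), the bound on the size of a partial spread of t-spaces in a
    quotient of dimension n - t. *)
Let lam : rat := (q ^+ n - q ^+ t) / (q ^+ (2 * t) - q ^+ t).

Let den_gt0 : 0 < q ^+ (2 * t) - q ^+ t.
Proof. by rewrite subr_gt0 ltr_eXn2l //; lia. Qed.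

Lemma lam_gt1 : 1 < lam.
Proof.
rewrite ltr_pdivlMr // mul1r ltrD2r ltr_eXn2l // -k_even; lia.
Qed.

Let c_gt0 : 0 < c. Proof. by rewrite gauss_binom_gt0 ?finNzRing_gt1 //; lia. Qed.

(** Two scattered members through [T] meet only in [T], so a (t+1)-space above [T] lies in at most
    one of them. Reaching [lam] means that all these (t+1)-spaces are used up. *)
Lemma card_scattered_through T : T \in heavy t V ->
  #|[set H in FF | scattered H & (T <= H)%VS]|%:R <= lam /\
  (#|[set H in FF | scattered H & (T <= H)%VS]|%:R = lam ->
   forall P, P \in between T V 1 -> exists2 H, H \in FF & (P <= H)%VS).
Proof.
rewrite mem_heavy => /and3P[_ /eqP dimT _].
set G := [set H in FF | _].
have dc := double_count G (between T V 1) (fun H P => (P <= H)%VS).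
have e_gt0 : 0 < q ^+ t.+1 - q ^+ t by rewrite subr_gt0 ltr_eXn2l.
have le1 P : P \in between T V 1 -> (#|[set H in G | (P <= H)%VS]| <= 1)%N.
  rewrite inE => /and3P[_ _ /eqP dimP].
  apply/card_le1_eqP => H H'; rewrite !inE.
  move=> /andP[/and3P[HF scH TH] PH] /andP[/and3P[H'F scH' TH'] PH'].
  apply/eqP; apply: contraT => neqH.
  have := forallP scH H'; rewrite H'F neqH /= leqNgt => /negP[].
  by rewrite -dimT -addn1 -dimP dimvS // subv_cap PH PH'.
have sumG : (#|G|%:R * (q ^+ (2 * t) - q ^+ t) / (q ^+ t.+1 - q ^+ t)
     = (\sum_(P in between T V 1) #|[set H in G | (P <= H)%VS]|)%:R).
  rewrite -dc natr_sum -mulrA mulr_natl -sumr_const; apply: eq_bigr => H.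
  rewrite !inE => /and3P[HF _ TH]; have := card_between1 TH.
  rewrite dimT (dim_member FF_sub HF) k_even -/q => <-; congr _%:R.
  by apply: eq_card => P; rewrite !inE subvf /= -andbA; congr (_ && _); rewrite andbC.
have cardV : #|between T V 1|%:R = lam * (q ^+ (2 * t) - q ^+ t) / (q ^+ t.+1 - q ^+ t).
  by rewrite card_between1 ?subvf // dimT dimV divfK // gt_eqF.
have le_sum : (\sum_(P in between T V 1) #|[set H in G | (P <= H)%VS]| <= #|between T V 1|
     ?= iff [forall (P | P \in between T V 1), #|[set H in G | (P <= H)%VS]| == 1])%N.
  rewrite -[in X in (_ <= X ?= iff _)%N]sum1_card; apply: leqif_sum => P PT; apply/leqifP.
  case: eqP => // /eqP neq1; rewrite ltn_neqAle neq1 le1 //.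
split=> [|eq_lam P PT].
  rewrite -(ler_pM2r den_gt0) -(ler_pM2r (_ : 0 < (q ^+ t.+1 - q ^+ t)^-1)) ?invr_gt0 //.
  by rewrite sumG -cardV ler_nat le_sum.
have : (\sum_(P in between T V 1) #|[set H in G | (P <= H)%VS]| == #|between T V 1|)%N.
  by rewrite -(eqr_nat rat) -sumG cardV eq_lam.
rewrite le_sum => /forall_inP/(_ P PT)/eqP cardP.
have : (0 < #|[set H in G | (P <= H)%VS]|)%N by rewrite cardP.
by rewrite card_gt0 => /set0Pn[H]; rewrite !inE => /andP[/and3P[HF _ _] PH]; exists H.
Qed.

Lemma card_heavy_ub H : H \in FF -> #|heavy t H|%:R <= c.
Proof.
move=> HF; have dimH := dim_member FF_sub HF.
have qt_gt0 : 0 < q ^+ t + 1 by rewrite addr_gt0 ?exprn_gt0.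
rewrite -(ler_pM2r qt_gt0) -gauss_binom_double ?finNzRing_gt1 //.
apply: (intersecting_card_ub (U := H)) => //; first by rewrite dimH.
  by apply/subsetP => T; rewrite inE => /andP[].
move=> A B; rewrite !mem_heavy => /and3P[AH _ dA] /and3P[BH _ dB].
exact: (heavy_sum_neq FF_sub FF_cf HF AH BH dA dB).
Qed.

(** A (t+1)-space in the intersection with another member is heavy, so its q^((t+1)(t-1))
    complements in [H] are owned; [gauss_binom_mid_ub] compares this with [c]. *)
Lemma card_own_unscattered H : H \in FF -> ~~ scattered H -> c <= #|own s H|%:R.
Proof.
move=> HF; rewrite negb_forall => /existsP[H']; rewrite !negb_imply -ltnNge.
move=> /and3P[H'F neqH lt_dim].
have [|P [_ PHH dimP]] := @subspace_between_exists _ _ 0%VS (H :&: H')%VS t.+1 (sub0v _).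
  by rewrite dimv0.
move: PHH; rewrite subv_cap => /andP[PH PH'].
have dP : (1 < deg P)%N by apply: deg_gt1 HF H'F _ PH PH'; rewrite eq_sym.
have := card_own_ge FF_sub FF_cf HF PH dimP dP.
have -> : (k - t.+1 = s)%N by rewrite k_even; clear; lia.
rewrite -(ler_nat rat) natrX; apply: le_trans.
have := gauss_binom_mid_ub (finNzRing_gt1 F) (ltn0Sn s).
by rewrite (_ : (s.+1 + 1) * (s.+1 - 1) = s.+2 * s)%N //; clear; lia.
Qed.

(** The weight discounts a heavy t-space of a scattered member by [lam], the most scattered members
    that can share it, and credits an unscattered member with [c] for its owned s-spaces. Owned and
    heavy t-spaces total c(q^t + 1), so a scattered member weighs least when it has the maximal
    number [c] of heavy ones, and an unscattered member always weighs strictly more. *)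
Lemma member_weight H : H \in FF ->
  c * (q ^+ t + lam^-1) <= #|own t H|%:R + (if scattered H then #|heavy t H|%:R / lam else c)
    ?= iff (scattered H && (#|heavy t H|%:R == c)).
Proof.
move=> HF; have lam1 := lam_gt1.
have lam_gt0 : 0 < lam := lt_trans ltr01 lam1.
have lamV1 : lam^-1 < 1 by rewrite invf_lt1.
have : #|own t H|%:R + #|heavy t H|%:R = c * (q ^+ t + 1).
  rewrite -natrD card_own_heavy // -gauss_binom_double ?finNzRing_gt1 //.
  by rewrite card_subspaces_of_dim (dim_member FF_sub HF) k_even //; clear; lia.
have := card_heavy_ub HF; set a := #|own t H|%:R; set b := #|heavy t H|%:R.
set l := lam^-1 in lamV1 *; rewrite -/l => le_bc eq_ab.
have -> : a = c * (q ^+ t + 1) - b by rewrite -eq_ab addrK.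
case: (scattered H) => /=; apply/leifP.
  have -> : c * (q ^+ t + l) = c * (q ^+ t + 1) - b + b / lam - (c - b) * (1 - l).
    by rewrite /l; ring.
  case: eqP => [->|/eqP neq_bc]; first by rewrite subrr mul0r subr0.
  by rewrite ltrBlDr ltrDl mulr_gt0 ?subr_gt0 // lt_neqAle neq_bc le_bc.
have : 0 < c * (1 - l) by rewrite mulr_gt0 ?subr_gt0.
by lra.
Qed.

(** The ratio of the two binomials is (q^n - 1)/(q^(n-t) - 1), which is q^t + (q^t - 1)/(q^(n-t) -
    1). *)
Lemma target_weight : g n t = g (n - 1) t * (q ^+ t + lam^-1).
Proof.
have := @gauss_binom_pred #|F| (n - 1) t; rewrite -/q.
have -> : (n - 1).+1 = n by lia.
move=> /(_ _)/(canRL (mulfK _)) -> //; last 2 first.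
- by rewrite exprB1_neq0 ?finNzRing_gt1 // subn_gt0; lia.
- by lia.
rewrite -mulrA /lam; congr (_ * _).
have -> : q ^+ n = q ^+ t * q ^+ (n - t) by rewrite -exprD subnKC //; lia.
have -> : q ^+ (2 * t) = q ^+ t * q ^+ t by rewrite -exprD addnn mul2n.
have : q ^+ (n - t) - 1 != 0 by rewrite exprB1_neq0 ?finNzRing_gt1 // subn_gt0; lia.
have : q ^+ t - 1 != 0 by rewrite exprB1_neq0 ?finNzRing_gt1.
have : q ^+ t != 0 by rewrite expf_neq0 // gt_eqF.
set x := q ^+ t; set y := q ^+ (n - t) => x0 x1 y1; clearbody x y.
have xy : x * y - x != 0 by rewrite -[X in _ - X]mulr1 -mulrBr mulf_neq0.
have xx : x * x - x != 0 by rewrite -[X in _ - X]mulr1 -mulrBr mulf_neq0.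
by field; rewrite ?x0 ?x1 ?y1 ?xy ?xx.
Qed.

(** The weights sum to at most the number of t-spaces: owned ones count once, heavy ones at most
    once, and the credits of unscattered members are paid by uncovered ones. Comparing with
    [member_weight] and [target_weight] gives the bound, and equality makes each of these estimates
    tight. *)
Lemma even_family_le :
  (#|FF|%:R * c <= g (n - 1) t) /\
  (#|FF|%:R * c = g (n - 1) t ->
    [/\ forall T, \dim T = t -> (0 < deg T)%N,
        forall H, H \in FF -> scattered H,
        forall H, H \in FF -> #|heavy t H|%:R = c
      & forall T P, T \in heavy t V -> P \in between T V 1 ->
          exists2 H, H \in FF & (P <= H)%VS]).
Proof.
have lam1 := lam_gt1; have lam_gt0 : 0 < lam := lt_trans ltr01 lam1.
pose mu := q ^+ t + lam^-1.
have mu_gt0 : 0 < mu by rewrite addr_gt0 ?exprn_gt0 ?invr_gt0.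
have lt_2s : (2 * s < k)%N by lia.
have le_unc := own_le_uncovered lt_2s.
have gE : g n t = (#|uncovered t|%:R + #|own t V|%:R) + #|heavy t V|%:R.
  by rewrite -!natrD card_deg_partition card_subspaces_of_dim dimV //; lia.
pose w H : rat := #|own t H|%:R + (if scattered H then #|heavy t H|%:R / lam else c).
have le_w : \sum_(H in FF) c * mu <= \sum_(H in FF) w H
    ?= iff [forall (H | H \in FF), scattered H && (#|heavy t H|%:R == c)].
  by apply: leif_sum => H HF; apply: member_weight.
rewrite sumr_const -mulr_natl mulrA -/mu in le_w.
have sum_w : \sum_(H in FF) w H = #|own t V|%:R +
    (\sum_(H in FF | scattered H) #|heavy t H|%:R / lam + \sum_(H in FF | ~~ scattered H) c).
  rewrite /w big_split /= -natr_sum sum_card_own; congr (_ + _).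
  rewrite (bigID scattered) /=; congr (_ + _); apply: eq_bigr => H /andP[_];
    by [move=> -> | move/negPf => ->].
have le_heavy : \sum_(H in FF | scattered H) #|heavy t H|%:R / lam <= #|heavy t V|%:R ?= iff
    [forall (T | T \in heavy t V), #|[set H in FF | scattered H & (T <= H)%VS]|%:R == lam].
  rewrite -mulr_suml -natr_sum sum_card_heavy natr_sum mulr_suml.
  rewrite -[X in _ <= X ?= iff _]mulr1 mulr_natl -sumr_const.
  apply: leif_sum => T TV; have [le_lam _] := card_scattered_through TV.
  split; first by rewrite ler_pdivrMr // mul1r.
  by rewrite -(inj_eq (mulIf (lt0r_neq0 lam_gt0))) divfK ?mul1r ?lt0r_neq0.
have le_c : \sum_(H in FF | ~~ scattered H) c <= #|own s V|%:R.
  rewrite -sum_card_own natr_sum [leRHS](bigID scattered) /= -[leLHS]add0r.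
  apply: lerD; first by apply: sumr_ge0 => *.
  by apply: ler_sum => H /andP[]; apply: card_own_unscattered.
have le_own : #|own s V|%:R <= #|uncovered t|%:R :> rat by rewrite ler_nat le_unc.
have tw : g n t = g (n - 1) t * mu := target_weight.
have leif_w := le_w; case: le_w => le_w _; have [le_h _] := le_heavy.
split=> [|eq_c].
  by rewrite -(ler_pM2r mu_gt0) -tw gE (le_trans le_w) // sum_w; lra.
have eq_w : #|FF|%:R * c * mu = g n t by rewrite tw eq_c.
have unc0 : #|uncovered t| = 0%N.
  apply/eqP; rewrite -le_unc.2 -(eqr_nat rat) eq_le le_own /=.
  by rewrite -eq_w in gE; rewrite sum_w in le_w; lra.
have /forall_inP allH : [forall (H | H \in FF), scattered H && (#|heavy t H|%:R == c)].
  rewrite -leif_w.2 eq_le le_w /= eq_w gE sum_w; lra.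
split.
- move=> T dimT; rewrite lt0n; apply/negP => /eqP dT.
  have : T \in uncovered t by rewrite mem_uncovered dimT dT !eqxx.
  by rewrite (cards0_eq unc0) inE.
- by move=> H /allH/andP[].
- by move=> H /allH/andP[_ /eqP].
- move=> T P TV; apply: (card_scattered_through TV).2.
  have /forall_inP allT : [forall (T | T \in heavy t V),
      #|[set H in FF | scattered H & (T <= H)%VS]|%:R == lam].
    rewrite -le_heavy.2 eq_le le_h /=.
    by rewrite -eq_w in gE; rewrite sum_w in le_w; lra.
  exact/eqP/allT.
Qed.

End EvenDimension.
End Bounds.

(** * The common point in the extremal even case *)

Lemma dim_add_above (F : fieldType) (vT : vectType F) (B X Y : {vspace vT}) :
  (B <= X)%VS -> (B <= Y)%VS -> \dim X = (\dim B).+1 -> \dim Y = (\dim B).+1 ->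
  X != Y -> \dim (X + Y) = (\dim B).+2.
Proof.
move=> BX BY dimX dimY neqXY.
have BXY : (\dim B <= \dim (X :&: Y))%N by rewrite dimvS // subv_cap BX BY.
have := dimv_sum_cap X Y; rewrite dimX dimY.
suff : (\dim (X :&: Y) < (\dim B).+1)%N by lia.
rewrite ltnNge; apply: contra neqXY => le_cap.
have /eqP XYX : (X :&: Y == X)%VS by rewrite eqEdim capvSl dimX.
have /eqP XYY : (X :&: Y == Y)%VS by rewrite eqEdim capvSr dimY.
by rewrite -{1}XYX XYY.
Qed.

Lemma exists_above_notin (F : fieldType) (vT : vectType F) (B H : {vspace vT}) :
  (B <= H)%VS -> (\dim H < \dim {:vT})%N ->
  exists X, [/\ (B <= X)%VS, \dim X = (\dim B).+1 & ~~ (X <= H)%VS].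
Proof.
move=> BH ltH; have : ~~ ({:vT} <= H)%VS by apply: contraL ltH => /dimvS; rewrite leqNgt.
case/subvPn => v _ vNH; exists (B + <[v]>)%VS; split; first exact: addvSl.
  have v0 : v != 0 by apply: contraNneq vNH => ->; rewrite mem0v.
  rewrite dimv_disjoint_sum ?dim_vline ?v0 ?addn1 //; apply/eqP; rewrite -subv0.
  apply/subvP => x /memv_capP[xB /vlineP[a eqx]]; rewrite memv0.
  apply: contraR vNH => x0; have a0 : a != 0 by apply: contraNneq x0 => a0; rewrite eqx a0 scale0r.
  by rewrite -[v]scale1r -(mulVf a0) -scalerA -eqx memvZ // (subvP BH).
by rewrite subv_add BH /= -memvE.
Qed.

Section Structure.
Variables (F : finFieldType) (vT : vectType F) (FF : {set {vspace vT}}).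
Implicit Types A B C T U H X : {vspace vT}.
Let q : rat := #|F|%:R.
Local Notation g := (gauss_binom #|F|).
Local Notation V := (fullv : {vspace vT}).
Local Notation deg := (deg FF).
Local Notation heavy := (heavy FF).

Variables (s : nat).
Local Notation t := s.+1.
Local Notation c := (g (2 * t - 1) t).
Hypotheses (FF_sub : FF \subset subspaces_of_dim V (2 * t)).
Hypotheses (FF_cf : cover_free FF) (lt_kn : (2 * t < \dim V)%N).
Hypothesis covered : forall T, \dim T = t -> (0 < deg T)%N.
Hypothesis FF_scattered : forall H, H \in FF -> scattered FF s H.
Hypothesis card_heavy : forall H, H \in FF -> #|heavy t H|%:R = c.
Hypothesis covered_above : forall T P, T \in heavy t V -> P \in between T V 1 ->
  exists2 H, H \in FF & (P <= H)%VS.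

Lemma scattered_inj P H H' : (t < \dim P)%N -> H \in FF -> H' \in FF ->
  (P <= H)%VS -> (P <= H')%VS -> H = H'.
Proof.
move=> ltP HF H'F PH PH'; apply/eqP; apply: contraT => neqH.
have /forallP/(_ H') := FF_scattered HF; rewrite H'F eq_sym neqH /= leqNgt => /negP[].
by apply: leq_trans ltP _; rewrite dimvS // subv_cap PH PH'.
Qed.

Lemma heavy_join B T1 T2 : \dim B = s -> \dim T1 = t -> \dim T2 = t ->
  (B <= T1)%VS -> (B <= T2)%VS -> T1 != T2 -> (1 < deg T1)%N ->
  exists2 H, H \in FF & (T1 <= H)%VS && (T2 <= H)%VS.
Proof.
move=> dimB dimT1 dimT2 BT1 BT2 neqT d1.
have [||H HF] := @covered_above T1 (T1 + T2)%VS.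
- by rewrite mem_heavy subvf dimT1 eqxx.
- rewrite inE addvSl subvf dimT1 (dim_add_above BT1 BT2) ?dimB //.
  by rewrite addn1 eqxx.
by rewrite subv_add; exists H.
Qed.

(** Let [H0] contain [T1 + T2]. An owned t-space above [B] outside [H0] would have an owner
    containing [T1] and [T2], which is [H0] by scatteredness. If [T] lies in [H0], joining it to a
    heavy [X] outside [H0] gives a second member through [T]. *)
Lemma heavy_pencil B T1 T2 T : \dim B = s -> \dim T1 = t -> \dim T2 = t -> \dim T = t ->
  (B <= T1)%VS -> (B <= T2)%VS -> (B <= T)%VS -> T1 != T2 ->
  (1 < deg T1)%N -> (1 < deg T2)%N -> (1 < deg T)%N.
Proof.
move=> dimB dimT1 dimT2 dimT BT1 BT2 BT neqT d1 d2.
have [H0 H0F /andP[T1H0 T2H0]] := heavy_join dimB dimT1 dimT2 BT1 BT2 neqT d1.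
have outside X : \dim X = t -> (B <= X)%VS -> ~~ (X <= H0)%VS -> (1 < deg X)%N.
  move=> dimX BX XNH0; rewrite ltn_neqAle covered // andbT; apply/eqP => dX.
  have neq1 : T1 != X by apply: contraNneq XNH0 => <-.
  have neq2 : T2 != X by apply: contraNneq XNH0 => <-.
  have [H1 H1F /andP[T1H1 XH1]] := heavy_join dimB dimT1 dimX BT1 BX neq1 d1.
  have [H2 H2F /andP[T2H2 XH2]] := heavy_join dimB dimT2 dimX BT2 BX neq2 d2.
  have eqH := deg1_inj (esym dX) H1F H2F XH1 XH2; rewrite -eqH in T2H2.
  have eqH0 : H1 = H0.
    apply: (@scattered_inj (T1 + T2)%VS); rewrite ?subv_add ?T1H1 ?T1H0 //.
    by rewrite (dim_add_above BT1 BT2) ?dimB //.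
  by rewrite -eqH0 XH1 in XNH0.
have [TH0|] := boolP (T <= H0)%VS; last exact: outside.
have dimH0 : \dim H0 = (2 * t)%N := dim_member FF_sub H0F.
have [||X [BX dimX XNH0]] := @exists_above_notin _ _ B H0; first exact: subv_trans TH0.
  by rewrite dimH0.
rewrite dimB in dimX; have dX := outside X dimX BX XNH0.
rewrite ltn_neqAle covered // andbT; apply/eqP => dT.
have neqX : X != T by apply: contraNneq XNH0 => ->.
have [H1 H1F /andP[XH1 TH1]] := heavy_join dimB dimX dimT BX BT neqX dX.
by rewrite (deg1_inj (esym dT) H0F H1F TH0 TH1) XH1 in XNH0.
Qed.

Definition full X := [forall T, ((\dim T == t) && (X <= T)%VS) ==> (1 < deg T)%N].

Lemma fullP X : reflect (forall T, \dim T = t -> (X <= T)%VS -> (1 < deg T)%N) (full X).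
Proof.
apply: (iffP forallP) => [fX T dimT XT|fX T].
  by have := fX T; rewrite dimT eqxx XT.
by apply/implyP => /andP[/eqP]; apply: fX.
Qed.

Lemma fullS X Y : (X <= Y)%VS -> full X -> full Y.
Proof. by move=> XY /fullP fX; apply/fullP => T dT YT; apply: fX => //; apply: subv_trans YT. Qed.

(** Induction on the codimension of [C] below t, with [heavy_pencil] as the last level. It suffices
    that every [Z] one dimension above [C] is full, because every t-space above [C] contains such a
    [Z]. *)
Lemma full_pencil C X Y : (\dim C < t)%N ->
  \dim X = (\dim C).+1 -> \dim Y = (\dim C).+1 ->
  (C <= X)%VS -> (C <= Y)%VS -> X != Y -> full X -> full Y -> full C.
Proof.
have [m lt_m] : exists m, (t - \dim C <= m)%N by exists (t - \dim C)%N.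
elim: m C X Y lt_m => [|m IHm] C X Y lt_m ltC; first by lia.
move=> dimX dimY CX CY neqXY fX fY.
have [eqC|neqC] := eqVneq (\dim C) s.
  rewrite eqC in dimX dimY.
  apply/fullP => T dimT CT; apply: (heavy_pencil eqC dimX dimY) => //.
    by move/fullP: fX => ->.
  by move/fullP: fY => ->.
have ltCs : (\dim C < s)%N by lia.
(* Joining [Z] to two full spaces gives two full spaces above [Z]; if they are distinct, induction
   applies to [Z]. *)
have IH Z A B : \dim Z = (\dim C).+1 -> (C <= Z)%VS -> full A -> full B ->
    \dim A = (\dim C).+1 -> \dim B = (\dim C).+1 -> (C <= A)%VS -> (C <= B)%VS ->
    A != Z -> B != Z -> (Z + A)%VS != (Z + B)%VS -> full Z.
  move=> dimZ CZ fA fB dimA dimB CA CB neqA neqB neqZ.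
  apply: (IHm Z (Z + A)%VS (Z + B)%VS); rewrite ?addvSl //.
  - by rewrite dimZ; move: lt_m ltCs; clear; lia.
  - by rewrite dimZ.
  - by rewrite (dim_add_above CZ CA) ?dimZ // eq_sym.
  - by rewrite (dim_add_above CZ CB) ?dimZ // eq_sym.
  - by apply: fullS fA; apply: addvSr.
  - by apply: fullS fB; apply: addvSr.
have dimXY := dim_add_above CX CY dimX dimY neqXY.
have outside Z : \dim Z = (\dim C).+1 -> (C <= Z)%VS -> ~~ (Z <= X + Y)%VS -> full Z.
  move=> dimZ CZ ZNXY.
  have neqX : X != Z by apply: contraNneq ZNXY => <-; rewrite addvSl.
  have neqY : Y != Z by apply: contraNneq ZNXY => <-; rewrite addvSr.
  apply: (IH Z X Y) => //; apply: contraNneq ZNXY => eqZ.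
  have : (X + Y == Z + X)%VS.
    by rewrite eqEdim subv_add addvSr eqZ addvSr dimXY (dim_add_above CZ CY) ?ltnSn // eq_sym.
  by move/eqP => ->; rewrite addvSl.
have fullZ Z : \dim Z = (\dim C).+1 -> (C <= Z)%VS -> full Z.
  move=> dimZ CZ; have [ZXY|] := boolP (Z <= X + Y)%VS; last exact: outside.
  have [<-//|neqX] := eqVneq X Z.
  (* For [Z] inside [X + Y] the joins with [X] and [Y] may coincide, so [Y] is replaced by a space
     [W] outside, already known to be full. *)
  have [||W [CW dimW WNXY]] := @exists_above_notin _ _ C (X + Y)%VS.
  - by apply: subv_trans CX (addvSl _ _).
  - by rewrite dimXY; apply: leq_ltn_trans lt_kn; move: ltCs; clear; lia.
  have neqW : W != Z by apply: contraNneq WNXY => ->.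
  apply: (IH Z X W) => //; first exact: outside.
  apply: contraNneq WNXY => eqZ.
  by apply: subv_trans (addvSr Z W) _; rewrite -eqZ subv_add ZXY addvSl.
apply/fullP => T dimT CT.
have [|Z [CZ ZT dimZ]] := subspace_between_exists (j := (\dim C).+1) CT; first by rewrite dimT; lia.
by move/fullP: (fullZ Z dimZ CZ) => ->.
Qed.

Definition full_in j H := [set X in subspaces_of_dim H j | full X].

Let q_gt1 : 1 < q. Proof. exact: card_order_gt1. Qed.
Let q_gt0 : 0 < q. Proof. exact: lt_trans q_gt1. Qed.

(** The right density to aim for is (q^j - 1)/(q^(2t) - 1), the proportion of j-spaces of [H]
    through a fixed point. It is attained by the heavy spaces at j = t and is carried down one
    dimension at a time. *)
Lemma full_density j H : H \in FF -> (0 < j <= t)%N ->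
  (q ^+ j - 1) * g (2 * t) j <= #|full_in j H|%:R * (q ^+ (2 * t) - 1).
Proof.
move=> HF; have dimH := dim_member FF_sub HF.
have [m eq_m] : exists m, (m = t - j)%N by exists (t - j)%N.
elim: m j eq_m => [|m IHm] j eq_m /andP[j_gt0 le_jt].
  have -> : j = t by lia.
  have -> : full_in t H = heavy t H.
    apply/setP => T; rewrite mem_heavy !inE -andbA; congr (_ && _).
    apply: andb_id2l => /eqP dimT; apply/fullP/idP => [->//|dT X dimX TX].
    suff -> : X = T by [].
    by apply/eqP; rewrite eq_sym eqEdim TX dimT dimX /=.
  rewrite card_heavy // gauss_binom_double ?finNzRing_gt1 // -/q.
  by rewrite mulnC exprM subr_sqr_1 mulrCA lexx.
have IH : (q ^+ j.+1 - 1) * g (2 * t) j.+1 <= #|full_in j.+1 H|%:R * (q ^+ (2 * t) - 1).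
  by apply: IHm; lia.
have lt_jt : (j < t)%N by lia.
have dc := double_count (full_in j.+1 H) (subspaces_of_dim H j) (fun X C => (C <= X)%VS).
pose e := (q ^+ (2 * t) - q ^+ j) / (q ^+ j.+1 - q ^+ j).
have eL : (\sum_(X in full_in j.+1 H) #|[set C in subspaces_of_dim H j | (C <= X)%VS]|)%:R
    = #|full_in j.+1 H|%:R * g j.+1 j.
  rewrite natr_sum mulr_natl -sumr_const; apply: eq_bigr => X.
  rewrite !inE => /andP[/andP[XH /eqP dimX] _].
  have <- : #|subspaces_of_dim X j|%:R = g j.+1 j by rewrite card_subspaces_of_dim dimX.
  congr _%:R; apply: eq_card => C; rewrite !inE andbC.
  case CX: (C <= X)%VS => //=; by rewrite (subv_trans CX XH).
(* A full j-space lies below at most [e] full (j+1)-spaces, the number of all (j+1)-spaces of [H]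
   above it; a j-space that is not full lies below at most one, by [full_pencil]. *)
have eR : (\sum_(C in subspaces_of_dim H j) #|[set X in full_in j.+1 H | (C <= X)%VS]|)%:R
    <= #|full_in j H|%:R * (e - 1) + g (2 * t) j.
  have <- : #|subspaces_of_dim H j|%:R = g (2 * t) j.
    by rewrite card_subspaces_of_dim dimH //; lia.
  rewrite natr_sum (bigID full) /= -(cardsID [set X | full X] (subspaces_of_dim H j)) natrD.
  have -> : subspaces_of_dim H j :&: [set X | full X] = full_in j H.
    by apply/setP => X; rewrite !inE.
  have sum1 : \sum_(C in subspaces_of_dim H j | full C)
      #|[set X in full_in j.+1 H | (C <= X)%VS]|%:R
      <= #|full_in j H|%:R * e.
    rewrite mulr_natl -sumr_const big_mkcondr /= [leRHS]big_mkcond [leLHS]big_mkcond.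
    apply: ler_sum => C _; rewrite [C \in full_in _ _]inE.
    case: ifP => //= CH; case: ifP => // fC.
    move: CH; rewrite inE => /andP[CH /eqP dimC].
    have := card_between1 CH; rewrite dimC dimH -/q -/e => <-.
    rewrite ler_nat; apply/subset_leq_card/subsetP => X.
    by rewrite !inE dimC addn1 => /andP[/andP[/andP[-> ->] _] ->].
  have sum2 : \sum_(C in subspaces_of_dim H j | ~~ full C)
      #|[set X in full_in j.+1 H | (C <= X)%VS]|%:R
      <= #|subspaces_of_dim H j :\: [set X | full X]|%:R :> rat.
    have -> : #|subspaces_of_dim H j :\: [set X | full X]|%:R
        = \sum_(C in subspaces_of_dim H j | ~~ full C) 1 :> rat.
      by rewrite -sum1_card natr_sum; apply: eq_bigl => C; rewrite !inE andbC.
    apply: ler_sum => C /andP[]; rewrite inE => /andP[CH /eqP dimC] fC.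
    rewrite (ler_nat _ _ 1); apply/card_le1_eqP => X Y; rewrite !inE -!andbA.
    move=> /and4P[_ /eqP dimX fX CX] /and4P[_ /eqP dimY fY CY].
    apply/eqP; apply: contraNT fC => neqXY.
    by apply: (full_pencil (X := Y) (Y := X)); rewrite ?dimC.
  by apply: le_trans (lerD sum1 sum2) _; lra.
rewrite -dc eL in eR.
have := gauss_binom_recr (finNzRing_gt1 F) (2 * t) j.
have := gauss_binom_hyper (finNzRing_gt1 F) j; rewrite -/q => hyp rec.
have x_neq0 : q ^+ j != 0 by rewrite expf_neq0 // gt_eqF.
have q1_gt0 : 0 < q - 1 by rewrite subr_gt0.
have q2t : q ^+ (2 * t) = q ^+ j * q ^+ (2 * t - j).
  by rewrite -exprD subnKC //; move: lt_jt; clear; lia.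
have eE : e * (q - 1) = q ^+ (2 * t - j) - 1.
  rewrite /e q2t exprSr.
  have -> : q ^+ j * q ^+ (2 * t - j) - q ^+ j = q ^+ j * (q ^+ (2 * t - j) - 1).
    by rewrite mulrBr mulr1.
  have -> : q ^+ j * q - q ^+ j = q ^+ j * (q - 1) by rewrite mulrBr mulr1.
  by rewrite invfM mulrACA divff // mul1r divfK // gt_eqF.
have yq_gt0 : 0 < q ^+ (2 * t - j) - q.
  by rewrite subr_gt0 -{1}[q]expr1 ltr_eXn2l //; move: lt_jt; clear; lia.
have xy_gt0 : 0 < q ^+ (2 * t) - 1 by rewrite exprB1_gt0 ?finNzRing_gt1.
have qx_gt0 : 0 < q ^+ j.+1 - 1 by rewrite exprB1_gt0 ?finNzRing_gt1.
rewrite -(ler_pM2l yq_gt0).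
have eR1 : #|full_in j.+1 H|%:R * (q ^+ j.+1 - 1) <=
    #|full_in j H|%:R * (q ^+ (2 * t - j) - q) + g (2 * t) j * (q - 1).
  rewrite -hyp mulrA; apply: le_trans (ler_wpM2r (ltW q1_gt0) eR) _.
  by rewrite mulrDl -mulrA mulrBl eE mul1r opprB addrA subrK.
have IH1 : (q ^+ j.+1 - 1) * (g (2 * t) j * (q ^+ (2 * t - j) - 1)) <=
   (#|full_in j H|%:R * (q ^+ (2 * t - j) - q) + g (2 * t) j * (q - 1)) * (q ^+ (2 * t) - 1).
  rewrite -rec [g _ j.+1 * _]mulrC.
  apply: le_trans (ler_wpM2l (ltW qx_gt0) IH) _.
  by rewrite mulrA ler_wpM2r ?(ltW xy_gt0) // mulrC.
move: IH1; rewrite q2t exprSr.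
move: (q ^+ j) (q ^+ (2 * t - j)) (g _ _) (#|full_in j H|%:R : rat) => x y G a.
lra.
Qed.

Lemma card_subspaces_double H : H \in FF -> #|subspaces_of_dim H t|%:R = c * (q ^+ t + 1).
Proof.
move=> HF; rewrite card_subspaces_of_dim (dim_member FF_sub HF); last lia.
by rewrite gauss_binom_double ?finNzRing_gt1.
Qed.

Lemma full_point H : H \in FF -> exists E, [/\ \dim E = 1%N, (E <= H)%VS & full E].
Proof.
move=> HF; have := full_density HF (isT : 0 < 1 <= t)%N.
have -> : (q ^+ 1 - 1) * g (2 * t) 1 = q ^+ (2 * t) - 1.
  rewrite mulrC; have := gauss_binom_recr (finNzRing_gt1 F) (2 * t) 0; rewrite -/q => ->.
  by rewrite /gauss_binom big_ord0 mul1r subn0.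
rewrite -[X in X <= _]mul1r ler_pM2r; last by rewrite exprB1_gt0 ?finNzRing_gt1.
rewrite (ler_nat _ 1) card_gt0 => /set0Pn[E]; rewrite !inE => /andP[/andP[EH /eqP dimE] fE].
by exists E.
Qed.

(** Two full points would make the zero space full and thus every t-space of [H] heavy, giving c(q^t
    + 1) heavy spaces instead of [c]. *)
Lemma full_point_unique H E E' : H \in FF -> \dim E = 1%N -> \dim E' = 1%N ->
  full E -> full E' -> E = E'.
Proof.
move=> HF dimE dimE' fE fE'; apply/eqP; apply: contraT => neqE.
have /fullP f0 : full 0%VS.
  by apply: (full_pencil (X := E) (Y := E')); rewrite ?dimv0 ?sub0v.
have heavy_all : heavy t H = subspaces_of_dim H t.
  apply/setP => T; rewrite mem_heavy mem_subspaces andbA.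
  by apply: andb_idr => /andP[_ /eqP dimT]; rewrite f0 ?sub0v.
have := card_heavy HF; rewrite heavy_all card_subspaces_double //.
have c_gt0 : 0 < c by rewrite gauss_binom_gt0 ?finNzRing_gt1 //; lia.
rewrite -[RHS]mulr1 => /(mulfI (lt0r_neq0 c_gt0))/eqP.
by rewrite -subr_eq0 addrK expf_eq0 gt_eqF.
Qed.

(** Each member has a full point, and by uniqueness it is the same [E] for all. *)
Lemma common_point : exists E, [/\ \dim E = 1%N, forall H, H \in FF -> (E <= H)%VS
  & forall T, \dim T = t -> (1 < deg T)%N -> (E <= T)%VS].
Proof.
have [|T0 [_ _ dimT0]] := subspace_between_exists (j := t) (sub0v V).
  by rewrite dimv0; lia.
have /deg_gt0P[H0 H0F _] := covered dimT0.
have [E [dimE EH0 fE]] := full_point H0F.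
have E_in H : H \in FF -> (E <= H)%VS.
  by case/full_point => E' [dimE' E'H fE']; rewrite (full_point_unique H0F dimE dimE').
exists E; split=> // T dimT dT.
have /deg_gt0P[H HF TH] := covered dimT; have EH := E_in H HF.
have dimH := dim_member FF_sub HF.
apply: contraT => ENT.
have ET0 : (E :&: T = 0)%VS.
  apply/eqP; rewrite -dimv_eq0; apply: contraR ENT; rewrite -lt0n => cap_gt0.
  have /eqP <- : (E :&: T == E)%VS by rewrite eqEdim capvSl dimE.
  exact: capvSr.
have ETH : (E + T <= H)%VS by rewrite subv_add EH TH.
(* If a heavy [T] missed [E], it would have a complement [E + D] in [H] through [E]. That complement
   is heavy because [E] is full, so two heavy spaces would span [H]. *)
pose D := (H :\: (E + T))%VS.
have dimET : \dim (E + T) = t.+1 by rewrite dimv_disjoint_sum // dimE dimT.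
have dimD : \dim D = s.
  have := dimv_cap_compl H (E + T)%VS; rewrite (capv_idPr ETH) dimET dimH -/D.
  by move: (\dim D); clear; lia.
have EDT : ((E + D) + T = H)%VS.
  rewrite -addvA [(D + T)%VS]addvC addvA addvC; have := addv_diff_cap H (E + T)%VS.
  by rewrite (capv_idPr ETH).
have dimED : \dim (E + D) = t.
  rewrite dimv_disjoint_sum ?dimE ?dimD //; apply/eqP; rewrite -subv0.
  by rewrite -(capv_diff H (E + T)%VS) capvC capvS // addvSl.
have EDH : (E + D <= H)%VS by rewrite -EDT addvSl.
have dED : (1 < deg (E + D))%N by move/fullP: fE; apply=> //; apply: addvSl.
by have := heavy_sum_neq FF_sub FF_cf HF EDH TH dED dT; rewrite EDT eqxx.
Qed.

End Structure.

(** * Steiner systems and the equality cases *)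

Section Steiner.
Variables (F : finFieldType) (vT : vectType F).
Implicit Types (E S T U W H : {vspace vT}) (FF HH : {set {vspace vT}}).
Local Notation g := (gauss_binom #|F|).

Lemma exists_unique_deg HH T :
  (exists! H : {vspace vT}, H \in HH /\ (T <= H)%VS) <-> deg HH T = 1%N.
Proof.
split=> [[H [[HF TH] uniqH]]|dT].
  apply/eqP/cards1P; exists H; apply/setP => H'; rewrite !inE.
  by apply/andP/eqP => [/uniqH ->|->].
have /deg_gt0P[H HF TH] : (0 < deg HH T)%N by rewrite dT.
exists H; split=> // H' [H'F TH']; exact: deg1_inj dT HF H'F TH TH'.
Qed.

(** Incidences of t-spaces with blocks: each t-space of [U] lies in one block, and each block
    contains [g k t] of them. *)
Lemma card_q_Steiner t k u U HH : (t <= k)%N -> (t <= u)%N ->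
  q_Steiner_system t k u U HH -> #|HH|%:R * g k t = g u t.
Proof.
move=> le_tk le_tu [dimU HHU uniqH].
have := double_count HH (subspaces_of_dim U t) (fun H T => (T <= H)%VS).
have -> : (\sum_(T in subspaces_of_dim U t) #|[set H in HH | (T <= H)%VS]| =
    #|subspaces_of_dim U t|)%N.
  by rewrite -sum1_card; apply: eq_bigr => T /uniqH/exists_unique_deg.
move/(congr1 (fun m => m%:R : rat)); rewrite card_subspaces_of_dim dimU // => <-.
rewrite natr_sum mulr_natl -sumr_const; apply: eq_bigr => H /(subsetP HHU).
rewrite inE => /andP[HU /eqP dimH].
have <- : #|subspaces_of_dim H t|%:R = g k t by rewrite card_subspaces_of_dim dimH.
congr _%:R; apply: eq_card => T; rewrite !inE.
apply/andP/andP => [[TH ->]|[/andP[_ ->] ->]] //.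
by rewrite TH (subv_trans TH HU).
Qed.

Lemma add_cap_complement E W H : (E + W = fullv)%VS -> (E <= H)%VS ->
  (E + (H :&: W) = H)%VS.
Proof.
move=> EW EH; apply/eqP; rewrite eqEsubv subv_add EH capvSl /=.
apply/subvP => x xH; have : x \in (E + W)%VS by rewrite EW memvf.
case/memv_addP => e eE [w wW eqx]; rewrite eqx memv_add // memv_cap wW andbT.
by rewrite -(addKr e w) -eqx memvD // memvN (subvP EH).
Qed.

Lemma cap_add_disjoint E W S : (E :&: W = 0)%VS -> (S <= W)%VS -> ((E + S) :&: W = S)%VS.
Proof.
move=> EW0 SW; apply/eqP; rewrite eqEsubv subv_cap addvSr SW !andbT.
apply/subvP => _ /memv_capP[/memv_addP[e eE [s sS ->]] esW].
have : e \in (E :&: W)%VS.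
  by rewrite memv_cap eE -(addrK s e) memvB // (subvP SW).
by rewrite EW0 memv0 => /eqP ->; rewrite add0r.
Qed.

End Steiner.

Theorem theorem1p2 (k t n : nat) (k_gt0 : (0 < k)%N) (t_gt0 : (0 < t)%N)
    (n_gt0 : (0 < n)%N) (le_k1_n : (k + 1 <= n)%N)
    (F : finFieldType) (vT : vectType F) (dimV : \dim {:vT} = n)
    (FF : {set {vspace vT}}) (FF_sub : FF \subset subspaces_of_dim {:vT} k)
    (FF_cf : cover_free FF) :
  (k = (2 * t)%N ->
     #|FF|%:R <= gauss_binom #|F| (n - 1) t / gauss_binom #|F| (2 * t - 1) t
     /\
     (#|FF|%:R = gauss_binom #|F| (n - 1) t / gauss_binom #|F| (2 * t - 1) t
      <->
      exists (E W : {vspace vT}) (SS : {set {vspace vT}}),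
        [/\ E \in subspaces_of_dim {:vT} 1,
            W \in subspaces_of_dim {:vT} (n - 1),
            (E :&: W)%VS = 0%VS /\ (E + W)%VS = {:vT}%VS,
            q_Steiner_system t (2 * t - 1) (n - 1) W SS
          & (forall S, S \in SS -> (E :&: S)%VS = 0%VS) /\
            FF = [set (E + S)%VS | S in SS]]))
  /\
  (k = (2 * t - 1)%N ->
     #|FF|%:R <= gauss_binom #|F| n t / gauss_binom #|F| (2 * t - 1) t
     /\
     (#|FF|%:R = gauss_binom #|F| n t / gauss_binom #|F| (2 * t - 1) t
      <->
      q_Steiner_system t (2 * t - 1) n {:vT}%VS FF)).
Proof.
rewrite addn1 in le_k1_n.
have c_gt0 : 0 < gauss_binom #|F| (2 * t - 1) t.
  by rewrite gauss_binom_gt0 ?finNzRing_gt1 //; lia.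
have eq_div x y : (x = y / gauss_binom #|F| (2 * t - 1) t) <->
    (x * gauss_binom #|F| (2 * t - 1) t = y).
  by split=> [->|<-]; rewrite ?divfK ?mulfK ?lt0r_neq0.
case: t t_gt0 c_gt0 eq_div => // s _ c_gt0 eq_div; split=> kE; rewrite ler_pdivlMr //.
  have [le_card eq_card] := even_family_le FF_sub dimV FF_cf le_k1_n kE.
  split=> //; apply: (iff_trans (eq_div _ _)); split=> [/eq_card|].
    rewrite kE in FF_sub le_k1_n.
    case=> covered scatt card_heavy above.
    have lt_dim : (2 * s.+1 < \dim {:vT})%N by rewrite dimV.
    have [E [dimE E_in E_heavy]] :=
      common_point FF_sub FF_cf lt_dim covered scatt card_heavy above.
    have EW0 : (E :&: E^C = 0)%VS := capv_compl E.
    have EHW0 H : (E :&: (H :&: E^C) = 0)%VS.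
      by rewrite [(H :&: _)%VS]capvC capvA EW0 cap0v.
    have dimW : \dim E^C = (n - 1)%N by rewrite dimv_compl dimE dimV.
    have FE H : H \in FF -> (E + (H :&: E^C) = H)%VS.
      by move=> /E_in; apply: add_cap_complement; apply: addv_complf.
    (* Any complement of the common point serves as W; the blocks are the traces of the members on
       it. *)
    exists E, (E^C)%VS, [set (H :&: E^C)%VS | H in FF]; split.
    - by rewrite inE subvf dimE.
    - by rewrite inE subvf dimW eqxx.
    - by rewrite EW0 addv_complf.
    - split=> //.
        apply/subsetP => _ /imsetP[H HF ->]; rewrite inE capvSr.
        have := dimv_disjoint_sum (EHW0 H).
        by rewrite FE // dimE (dim_member FF_sub HF) => ->; rewrite addKn eqxx.
      move=> T; rewrite inE => /andP[TW /eqP dimT].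
      (* Every heavy t-space contains [E], so a t-space of W is covered but not heavy. *)
      have /exists_unique_deg[H [[HF TH] uniqH]] : deg FF T = 1%N.
        have := covered T dimT; rewrite leq_eqVlt => /orP[/eqP//|/(E_heavy T dimT) ET].
        have : (E <= E :&: E^C)%VS by rewrite subv_cap subvv (subv_trans ET TW).
        by move/dimvS; rewrite EW0 dimE dimv0.
      exists (H :&: E^C)%VS; split; first by split; [apply: imset_f | rewrite subv_cap TH TW].
      move=> _ [/imsetP[H' H'F ->]]; rewrite subv_cap => /andP[TH' _].
      by rewrite (uniqH H').
    - split=> [_ /imsetP[H HF ->]|]; first exact: EHW0.
      apply/setP => H; rewrite -imset_comp; apply/idP/imsetP => [HF|[H' H'F -> /=]].
        by exists H; rewrite //= FE.
      by rewrite FE.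
  case=> E [W [SS [dimE dimW [EW0 EW] steiner [ES0 ->]]]].
  (* The map sending S to E + S is injective on blocks, since S is recovered as the intersection of
     E + S with W. *)
  rewrite card_in_imset; first by apply: card_q_Steiner steiner; lia.
  case: steiner => _ SSW _ S S' /(subsetP SSW) + /(subsetP SSW).
  rewrite !inE => /andP[SW _] /andP[S'W _] eqS.
  by rewrite -(cap_add_disjoint EW0 SW) eqS cap_add_disjoint.
have kE' : k = (2 * s).+1 by lia.
have [le_card eq_card] := odd_family_le FF_sub dimV FF_cf le_k1_n kE'.
rewrite -kE; split=> //; rewrite kE; apply: (iff_trans (eq_div _ _)); rewrite -kE.
split=> [/eq_card deg1|]; last by apply: card_q_Steiner; lia.
split=> // T; rewrite inE => /andP[_ /eqP dimT].
by apply/exists_unique_deg/deg1.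
Qed.
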